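(* If $q$ is odd and fixed, then $$\lim_{n\to\infty}\frac{i(\Omega(2n+1,q))}{q^{n^2+n}}=\frac12\prod_{i\ge 1}(1+1/q^{2i})^2.$$
   Context: $q$ is an odd prime power. $\mathrm{O}(2n+1,q)$ is the isometry group of the quadratic form $x_1x_2+x_3x_4+\cdots+x_{2n-1}x_{2n}+x_{2n+1}^2$ on $\mathbb{F}_q^{2n+1}$ (any other non-degenerate quadratic form on $\mathbb{F}_q^{2n+1}$ gives an isomorphic group), $\mathrm{SO}(2n+1,q)$ is its subgroup of determinant $1$ elements, and $\Omega(2n+1,q)$ is the derived subgroup of $\mathrm{SO}(2n+1,q)$ (of index $2$ in it for $n\ge 1$). $i(X)$ denotes the number of $g\in X$ with $g^2=1$ (the identity is counted). *)

(* Defs.v *)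
From HB Require Import structures.
From mathcomp Require Import all_boot all_order all_algebra all_fingroup all_solvable.

Set Implicit Arguments.
Unset Strict Implicit.
Unset Printing Implicit Defensive.

Import GroupScope GRing.Theory.
Local Open Scope ring_scope.

Section OddOrthogonal.
Variables (n : nat) (F : finFieldType).

(* The coordinates x_1, ..., x_(2n+1) are indexed from 0, so x_(2k+1) has index
   2k, and x_(2n+1) has index ord_max. *)
Definition odd_qform (x : 'cV[F]_n.*2.+1) : F :=
  \sum_(k < n) x (inord k.*2) 0 * x (inord k.*2.+1) 0 + x ord_max 0 ^+ 2.

Definition odd_GO : {set {'GL_n.*2.+1[F]}} :=
  [set g : {'GL_n.*2.+1[F]} |
    [forall x : 'cV[F]_n.*2.+1, odd_qform (GLval g *m x) == odd_qform x]].

Definition odd_SO : {set {'GL_n.*2.+1[F]}} :=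
  [set g in odd_GO | \det (GLval g) == 1].

Lemma odd_GO_group_set : group_set odd_GO.
Proof.
apply/group_setP; split=> [|g h].
  by rewrite inE; apply/forallP=> x; rewrite GL_1E mul1mx.
rewrite !inE => /forallP gP /forallP hP; apply/forallP=> x.
by rewrite GL_ME -mulmxA (eqP (gP _)) hP.
Qed.

Canonical odd_GO_group := Group odd_GO_group_set.

Lemma odd_SO_group_set : group_set odd_SO.
Proof.
apply/group_setP; split=> [|g h].
  by rewrite inE group1 GL_1E det1 eqxx.
rewrite inE => /andP[gO /eqP dg]; rewrite inE => /andP[hO /eqP dh].
by rewrite inE (groupM gO hO) GL_ME det_mulmx dg dh mulr1 eqxx.
Qed.

Canonical odd_SO_group := Group odd_SO_group_set.

Definition odd_Omega : {set {'GL_n.*2.+1[F]}} := (odd_SO^`(1))%g.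

End OddOrthogonal.

Definition num_sq1 (gT : finGroupType) (X : {set gT}) : nat :=
  #|[set g in X | (g ^+ 2 == 1)%g]|.

(* Main.v *)
(** Write q = #|F|.  An involution g of SO(2n+1,q) is determined by its
    (-1)-eigenspace, a nondegenerate subspace of some even dimension 2k, and
    g lies in Omega iff that subspace has square discriminant.  "If": the
    subspace then has an orthonormal basis, and splitting it in two halves
    [E1], [E2] writes g as the commutator of the involutions attached to [E1]
    and [E1 - E2].  "Only if": the sign of the permutation induced on the sphere
    {Q = 1} is a character of SO, and the number of fixed points on the sphere
    separates the two discriminants modulo 4.  Counting orthonormal frames, one
    vector at a time, gives the number of g with given k:
      q^(4k(n-k)+2k) (1 + e_k q^-k) / 2 * [n,k]_p,   p = q^-2, e_k = +-1.
    Put w(n,k) = q^(4k(n-k)+2k) / q^(n^2+n).  These weights concentrate around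
    k = n/2, so, with (y)_oo = prod_(i >= 1) (1 - y^i), the required sum is
    asymptotic to (1/2) sum_k w(n,k) / (p)_oo.  With base p^4 in place of p the
    sum is a product: sum_k w(n,k) [n,k]_(p^4) = prod_(i < n) (1 + p^(2i+1)).
    Hence sum_k w(n,k) tends to (p^4)_oo prod_(i >= 0) (1 + p^(2i+1)), which
    equals (p^2)_oo^2 / (p)_oo. *)

Require Import Defs.
From HB Require Import structures.
From mathcomp Require Import all_boot all_order all_algebra all_fingroup all_solvable.
From mathcomp Require Import ring lra zify.

Set Implicit Arguments.
Unset Strict Implicit.
Unset Printing Implicit Defensive.

Import Order.TTheory GRing.Theory Num.Theory.
Local Open Scope ring_scope.

(** * The quadratic character *)

Section QuadraticCharacter.
Variable F : finFieldType.
Hypothesis oddF : odd #|F|.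
Implicit Types a b c t y : F.

Let q : int := #|F|%:Z.

(** The Legendre symbol of [F]. Defined by counting, it makes [1 + eta a] the number of square roots
    of [a] from the start. *)
Definition quadchar (a : F) : int := #|[set y : F | y ^+ 2 == a]|%:Z - 1.
Local Notation eta := quadchar.

Lemma two_neq0 : 2 != 0 :> F.
Proof.
apply/eqP => h2.
have: (#[1%R : F]%g %| #|[set: F]|)%N by rewrite order_dvdG ?inE.
have -> : #[1%R : F]%g = 2%N.
  apply: nt_prime_order => //; last exact: oner_neq0.
by rewrite cardsT dvdn2 oddF.
Qed.

Lemma quadchar0 : eta 0 = 0.
Proof.
rewrite /quadchar (_ : [set y | _] = [set 0]) ?cards1 //.
by apply/setP => y; rewrite !inE sqrf_eq0.
Qed.

Lemma quadchar_sqr y : y != 0 -> eta (y ^+ 2) = 1.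
Proof.
move=> y0; rewrite /quadchar (_ : [set x | _] = [set y; - y]).
  rewrite cards2 -subr_eq0 opprK -mulr2n -mulr_natl mulf_eq0.
  by rewrite (negPf two_neq0) (negPf y0).
by apply/setP => x; rewrite !inE eqf_sqr.
Qed.

Variant quadchar_spec a : int -> Type :=
| QuadcharZero of a = 0 : quadchar_spec a 0
| QuadcharSquare y of a = y ^+ 2 & y != 0 : quadchar_spec a 1
| QuadcharNonsquare of a != 0 & (forall y, a != y ^+ 2) : quadchar_spec a (-1).

Lemma quadcharP a : quadchar_spec a (eta a).
Proof.
have [->|a0] := eqVneq a 0; first by rewrite quadchar0; constructor.
case: (pickP [pred y | a == y ^+ 2]) => [y /= /eqP ay|h].
  have y0 : y != 0 by apply: contraNneq a0 => y0; rewrite ay y0 expr0n.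
  by rewrite {2}ay quadchar_sqr //; apply: (QuadcharSquare ay).
rewrite /quadchar (_ : [set y | _] = set0).
  by rewrite cards0; constructor=> // y; apply/negbT/h.
by apply/setP => y; rewrite !inE eq_sym; apply: h.
Qed.

Lemma sum_card_sqrt (V : nmodType) (f : F -> V) :
  \sum_y f (y ^+ 2) = \sum_t f t *+ #|[set y : F | y ^+ 2 == t]|.
Proof.
rewrite (partition_big (fun y => y ^+ 2) predT) //=; apply: eq_bigr => t _.
rewrite (eq_bigr (fun=> f t)) => [|y /eqP -> //].
by rewrite sumr_const; congr (_ *+ _); apply: eq_card => y; rewrite !inE.
Qed.

Lemma sum_quadchar : \sum_t eta t = 0.
Proof.
rewrite sumrB sumr_const.
have := sum_card_sqrt (fun=> 1 : int); rewrite sumr_const => ->.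
apply/eqP; rewrite subr_eq0; apply/eqP/eq_bigr => t _.
by rewrite natz.
Qed.

Lemma quadcharMsqr y t : y != 0 -> eta (y ^+ 2 * t) = eta t.
Proof.
move=> y0; congr (_%:Z - 1).
have yV : injective ( *%R y^-1) by apply/mulfI; rewrite invr_eq0.
rewrite -[RHS](card_preimset _ yV); apply: eq_card => x; rewrite !inE exprMn.
apply/eqP/eqP => [->|<-]; first by rewrite mulrA -exprMn mulVf // expr1n mul1r.
by rewrite mulrA -exprMn mulfV // expr1n mul1r.
Qed.

(** Only a nonsquare [a] needs an argument. Then [eta t + eta (a * t)] is never positive, while its
    sum over [t] is 0, so it vanishes for every [t]. *)
Lemma quadcharM a b : eta (a * b) = eta a * eta b.
Proof.
case: (quadcharP a) => [->|y -> y0|a0 ha]; rewrite ?mul0r ?quadchar0 //.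
  by rewrite quadcharMsqr // mul1r.
have sum0 : \sum_t (eta t + eta (a * t)) = 0.
  rewrite big_split /= sum_quadchar add0r.
  rewrite -(reindex (fun t => a * t) (P := predT)) ?sum_quadchar //=.
  by exists (fun t => a^-1 * t) => t _; rewrite mulrA (mulVf, mulfV) // mul1r.
have h t : 0 <= - (eta t + eta (a * t)).
  case: (quadcharP t) => [->|y -> y0|t0 ht].
  - by rewrite mulr0 quadchar0.
  - rewrite mulrC quadcharMsqr //; case: (quadcharP a) => [az|z az _|//].
      by rewrite az eqxx in a0.
    by have := ha z; rewrite az eqxx.
  - by case: quadcharP.
have := psumr_eq0P (P := predT) (fun t _ => h t).
rewrite sumrN sum0 oppr0 => /(_ erefl b isT) /eqP.
by rewrite oppr_eq0 addrC addr_eq0 mulN1r => /eqP.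
Qed.

Lemma quadchar_opts a : a != 0 -> eta a = 1 \/ eta a = -1.
Proof. by case: quadcharP => [->|y|_ _ _]; rewrite ?eqxx; auto. Qed.

Lemma sqr_quadchar a : a != 0 -> eta a * eta a = 1.
Proof. by case/quadchar_opts=> ->. Qed.

Lemma card_scaled_sqrt a c : a != 0 ->
  #|[set y : F | a * y ^+ 2 == c]|%:Z = 1 + eta (a * c).
Proof.
move=> a0; rewrite -(quadcharMsqr (a * c) (y := a^-1)) ?invr_eq0 //.
rewrite addrC /quadchar subrK; congr _%:Z; apply: eq_card => y; rewrite !inE.
have -> : a^-1 ^+ 2 * (a * c) = a^-1 * c by field.
by rewrite -[RHS](inj_eq (mulfI a0)) mulVKf.
Qed.

(** This is the sum of psi(c y) over nonzero y for a nontrivial additive character psi; point counts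
    of even-dimensional forms depend on [c] through it. *)
Definition fiber_weight c : int := if c == 0 then q - 1 else - 1.
Local Notation nu := fiber_weight.

Lemma sum_quadchar_affine a c : a != 0 -> \sum_t eta (c + a * t) = 0.
Proof.
move=> a0; rewrite -(reindex (fun t => c + a * t) (P := predT)) ?sum_quadchar //=.
exists (fun t => a^-1 * (t - c)) => t _; first by rewrite addrC addKr mulKf.
by rewrite mulVKf // addrC subrK.
Qed.

Lemma sum_quadchar_conic a c : a != 0 ->
  \sum_y eta (c - a * y ^+ 2) = nu c * eta (- a).
Proof.
move=> a0; rewrite /nu; have [->|c0] := eqVneq c 0.
  rewrite (bigD1 0) //= expr0n mulr0 subr0 quadchar0 add0r.
  rewrite (eq_bigr (fun=> eta (- a))) => [|y y0]; last first.
    by rewrite sub0r -mulNr mulrC quadcharMsqr.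
  rewrite sumr_const cardC1 -mulr_natl; congr (_ * _).
  by rewrite /q -(prednK (ltnW (card_finNzRing_gt1 F))) /= -natz; lia.
(* Summing over t = y^2 inserts the factor [1 + eta t]. The 1 contributes nothing, and t -> 1/t
   turns [eta (t * (c - a * t))] into [eta (- a + c * t)], whose full sum lacks only the term at
   0. *)
rewrite (sum_card_sqrt (fun t => eta (c - a * t))).
under eq_bigr => t _ do
  rewrite -mulr_natr natz -[_%:Z](subrK 1) mulrDr mulr1 -[_ - 1]/(eta t) -quadcharM.
rewrite big_split /= [X in _ + X](_ : _ = 0) ?addr0; last first.
  under eq_bigr do rewrite -mulNr.
  by rewrite sum_quadchar_affine ?oppr_eq0.
rewrite (bigD1 0) //= !mulr0 quadchar0 add0r.
rewrite (reindex_inj invr_inj) /=.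
transitivity (\sum_(t | t != 0) eta (- a + c * t)).
  apply: eq_big => [t|t]; rewrite invr_eq0 // => t0.
  rewrite -(quadcharMsqr _ t0); congr eta; field.
  by rewrite t0.
have := sum_quadchar_affine (- a) c0; rewrite (bigD1 0) //= mulr0 addr0.
by rewrite addrC mulN1r => /eqP; rewrite addr_eq0 => /eqP.
Qed.

Lemma sum_fiber_weight a c : a != 0 ->
  \sum_y nu (c - a * y ^+ 2) = q * eta (a * c).
Proof.
move=> a0.
transitivity (\sum_y (q *+ (a * y ^+ 2 == c) - 1)).
  by apply: eq_bigr => y _; rewrite /nu subr_eq0 eq_sym; case: eqP; rewrite ?sub0r.
rewrite sumrB sumr_const sumrMnr -mulr_natr natz.
have := card_scaled_sqrt c a0; rewrite -sum1dep_card big_mkcond /=.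
rewrite (eq_bigr (fun y => (a * y ^+ 2 == c) : nat)) => [->|y _]; last by case: eqP.
by rewrite mulrDr mulr1 natz addrC addKr.
Qed.

End QuadraticCharacter.

(** * Counting frames of quadratic forms *)

(* [orthfact q n] is the order of SO(2n+1,q). *)
Definition orthfact (T : comPzRingType) (x : T) n :=
  \prod_(j < n) (x ^+ j.*2.+1 * (x ^+ j.*2.+2 - 1)).

Section Frames.
Variable F : finFieldType.
Hypothesis oddF : odd #|F|.

Local Notation q := (#|F|%:Z).
Local Notation eta := (@quadchar F).
Local Notation nu := (@fiber_weight F).

(** For invertible [D] these are the isometric embeddings of the form [D] into the form [A]. *)
Definition frames n m (A : 'M[F]_n) (D : 'M[F]_m) : {set 'M[F]_(n, m)} :=
  [set E | E^T *m A *m E == D].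

Definition symunit n (A : 'M[F]_n) := (A^T == A) && (A \in unitmx).

Lemma symunit_congr n (A P : 'M[F]_n) :
  symunit A -> P \in unitmx -> symunit (P^T *m A *m P).
Proof.
move=> /andP[/eqP At Au] Pu; apply/andP; split.
  by rewrite !trmx_mul trmxK At mulmxA.
by rewrite !unitmx_mul unitmx_tr Pu Au.
Qed.

Lemma symunit_block m l (D : 'M[F]_m) (B : 'M[F]_l) :
  symunit (block_mx D 0 0 B) -> symunit B.
Proof.
rewrite /symunit tr_block_mx => /andP[/eqP/eq_block_mx[_ _ _ ->]].
by rewrite eqxx !unitmxE det_ublock unitrM => /andP[].
Qed.

Lemma card_frames_congr n m (A P : 'M[F]_n) (D : 'M[F]_m) :
  P \in unitmx -> #|frames (P^T *m A *m P) D| = #|frames A D|.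
Proof.
move=> Pu; have injP : injective (@mulmx F n n m P) by apply: can_inj (mulKmx Pu).
rewrite -(card_imset _ injP); apply: eq_card => E; apply/imsetP/idP.
  by move=> [G]; rewrite !inE => /eqP <- ->; rewrite trmx_mul !mulmxA.
rewrite !inE => /eqP ED; exists (invmx P *m E); last by rewrite mulKVmx.
rewrite inE trmx_mul -!mulmxA mulKVmx // (mulmxA _ P^T) -trmx_mul mulmxV //.
by rewrite trmx1 mul1mx mulmxA ED.
Qed.

(** Gram-Schmidt: extend [E] to a basis and subtract from the new vectors their projections to the
    span of [E]. Comparing determinants under this congruence gives the discriminant of the
    complement modulo squares. *)
Lemma frame_complement m l (A : 'M[F]_(m + l)) (D : 'M[F]_m) (E : 'M[F]_(_, m)) :
    symunit A -> D \in unitmx -> E \in frames A D ->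
  exists X : 'M[F]_(_, l), [/\ row_mx E X \in unitmx, E^T *m A *m X = 0,
    (row_mx E X)^T *m A *m row_mx E X = block_mx D 0 0 (X^T *m A *m X),
    symunit (X^T *m A *m X) &
    eta (\det (X^T *m A *m X)) = eta (\det A * \det D)].
Proof.
move=> Asu Du; rewrite inE => /eqP ED; have /andP[/eqP At Au] := Asu.
(* [row_mx 1%:M 0] selects the first [m] rows, so [g] is an invertible matrix that starts with
   [E^T]. *)
have [g gu gE] : {g : 'M_(m + l) | g \in unitmx &
    row_mx 1%:M 0 *m col_mx E^T (0 : 'M_(l, m + l)) = row_mx 1%:M 0 *m g}.
  apply: complete_unitmx; rewrite mul_row_col mul1mx mul0mx addr0.
  transitivity m; last apply/esym.
    by apply/eqP/row_freeP; exists (A *m E *m invmx D); rewrite !mulmxA ED mulmxV.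
  apply/eqP/row_freeP; exists (col_mx 1%:M 0).
  by rewrite mul_row_col mul1mx mul0mx addr0.
have gEY : g = col_mx E^T (dsubmx g).
  rewrite -[LHS]vsubmxK; congr col_mx; apply/esym; move: gE.
  by rewrite -{1}[g]vsubmxK !mul_row_col !mul1mx !mul0mx !addr0.
pose Y := (dsubmx g)^T; pose X : 'M_(m + l, l) := Y - E *m (invmx D *m E^T *m A *m Y).
have EX : E^T *m A *m X = 0.
  by rewrite mulmxBr !mulmxA ED mulmxV // mul1mx subrr.
have Xu : row_mx E X \in unitmx.
  have -> : row_mx E X = g^T *m block_mx 1%:M (- (invmx D *m E^T *m A *m Y)) 0 1%:M.
    rewrite [in RHS]gEY tr_col_mx trmxK mul_row_block mulmx1 mulmx0 addr0 mulmx1.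
    by rewrite mulmxN addrC.
  by rewrite unitmx_mul unitmx_tr gu unitmxE det_ublock !det1 mulr1 unitr1.
have PAP : (row_mx E X)^T *m A *m row_mx E X = block_mx D 0 0 (X^T *m A *m X).
  rewrite tr_row_mx mul_col_mx mul_col_row ED EX; congr block_mx.
  by have := congr1 trmx EX; rewrite !trmx_mul At trmxK trmx0 mulmxA.
have := symunit_congr Asu Xu; rewrite PAP => /symunit_block Bsu.
exists X; split=> //.
have := congr1 determinant PAP; rewrite det_ublock !det_mulmx det_tr => dd.
have D0 : \det D != 0 by rewrite -unitfE -unitmxE.
have P0 : \det (row_mx E X) != 0 by rewrite -unitfE -unitmxE.
rewrite -(quadcharMsqr (\det (X^T *m A *m X)) D0) expr2 -mulrA -dd.
rewrite -[RHS](quadcharMsqr _ P0); congr eta; ring.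
Qed.

(** A vector orthogonal to [E] has no component along [E], so the complement [X] gives it
    coordinates in which the form is [B]. [N] is kept apart from [m + l] because it will be
    [n.*2.+1]. *)
Lemma orthogonal_frames N m l (A : 'M[F]_N) (D : 'M[F]_m) (E : 'M[F]_(N, m)) :
    (m + l)%N = N -> symunit A -> D \in unitmx -> E \in frames A D ->
  exists B : 'M[F]_l, [/\ symunit B, eta (\det B) = eta (\det A * \det D) &
    forall p (D' : 'M[F]_p),
      #|[set G in frames A D' | E^T *m A *m G == 0]| = #|frames B D'| ].
Proof.
move=> Nml; move: A E; rewrite -{N}Nml => A E Asu Du EA.
have [X [Xu EX _ Bsu Bd]] := frame_complement Asu Du EA.
exists (X^T *m A *m X); split=> // p D'.
have injX : injective (@mulmx F _ _ p X).
  move=> Z Z' XZ.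
  have : row_mx E X *m col_mx 0 Z = row_mx E X *m col_mx 0 Z'.
    by rewrite !mul_row_col XZ.
  by move/(can_inj (mulKmx Xu))/eq_col_mx => [].
rewrite -(card_imset _ injX); apply: eq_card => G; rewrite inE.
apply/andP/imsetP => [[GD /eqP EG]|[Z]]; last first.
  rewrite !inE => ZD ->; rewrite mulmxA EX mul0mx eqxx; split=> //.
  by move: ZD; rewrite trmx_mul !mulmxA.
have [Z1 [Z2 GZ]] : exists Z1 Z2, G = E *m Z1 + X *m Z2.
  exists (usubmx (invmx (row_mx E X) *m G)), (dsubmx (invmx (row_mx E X) *m G)).
  by rewrite -mul_row_col vsubmxK mulKVmx.
have Z10 : Z1 = 0.
  move: EG; rewrite GZ mulmxDr !mulmxA EX mul0mx addr0.
  move: EA; rewrite inE => /eqP -> DZ.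
  by rewrite -[Z1](mulKmx Du) DZ mulmx0.
move: GZ GD; rewrite Z10 mulmx0 add0r => -> GD.
by exists Z2 => //; move: GD; rewrite !inE trmx_mul !mulmxA.
Qed.

(** The complement of [E] varies with [E], but its discriminant modulo squares does not; hence the
    count [f] is assumed uniform over that class. *)
Lemma card_frames_block m l p (A : 'M[F]_(m + l)) (D : 'M[F]_m) (D' : 'M[F]_p)
    (f : nat) : symunit A -> D \in unitmx ->
    (forall A' : 'M[F]_l, symunit A' -> eta (\det A') = eta (\det A * \det D) ->
       #|frames A' D'| = f) ->
  #|frames A (block_mx D 0 0 D')| = (#|frames A D| * f)%N.
Proof.
move=> Asu Du fP; have /andP[/eqP At Au] := Asu.
have blk (E : 'M_(_, m)) (G : 'M_(_, p)) :
    (row_mx E G \in frames A (block_mx D 0 0 D')) =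
    [&& E \in frames A D, G \in frames A D' & E^T *m A *m G == 0].
  rewrite !inE tr_row_mx mul_col_mx mul_col_row.
  apply/eqP/and3P => [/eq_block_mx[-> -> _ ->] //|[/eqP-> /eqP-> /eqP EG]].
  rewrite EG; congr block_mx.
  by have := congr1 trmx EG; rewrite !trmx_mul At trmxK trmx0 mulmxA.
rewrite -sum1_card (partition_big (fun G => lsubmx G) (mem (frames A D))) /=; last first.
  by move=> G; rewrite -{1}[G]hsubmxK blk => /and3P[].
rewrite -sum_nat_const; apply: eq_bigr => E EA.
have [B [Bsu Bd Bfr]] := @orthogonal_frames _ m l _ _ _ erefl Asu Du EA.
rewrite -(fP _ Bsu Bd) -Bfr sum1dep_card.
have injE : injective (fun G : 'M_(_, p) => row_mx E G) by move=> G G' /eq_row_mx[].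
rewrite -(card_imset _ injE); apply: eq_card => H; rewrite inE.
apply/andP/imsetP => [[HD /eqP lH]|[G]].
  move: HD; rewrite -[H]hsubmxK lH blk => /and3P[_ GD EG].
  by exists (rsubmx H); rewrite // inE GD.
by rewrite inE => /andP[GD EG] ->; rewrite blk EA GD EG row_mxKl eqxx.
Qed.

Lemma quadratic_eq0 n (A : 'M[F]_n) : A^T = A ->
  (forall x : 'cV_n, x^T *m A *m x = 0) -> A = 0.
Proof.
move=> At A0; pose e i : 'cV[F]_n := delta_mx i 0.
have coef i j : ((e i)^T *m A *m e j) 0 0 = A i j.
  by rewrite trmx_delta -rowE -colE !mxE.
apply/matrixP => i j; rewrite [RHS]mxE.
have Aii k : A k k = 0 by rewrite -coef A0 mxE.
have := congr1 (fun M : 'M_1 => M 0 0) (A0 (e i + e j)).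
have entryD (U V : 'M[F]_1) : (U + V) 0 0 = U 0 0 + V 0 0 by rewrite mxE.
rewrite /= [(_ + _)^T]raddfD /= !mulmxDl !mulmxDr !entryD !coef !Aii mxE.
have -> : A j i = A i j by rewrite -{1}At mxE.
rewrite add0r addr0 -mulr2n -mulr_natl => /eqP.
by rewrite mulf_eq0 (negPf (two_neq0 oddF)) => /eqP.
Qed.

Definition npts n (A : 'M[F]_n) (c : F) := #|frames A (c%:M : 'M_1)|.

Lemma exists_anisotropic n (A : 'M[F]_n.+1) : symunit A ->
  exists a (E : 'cV_n.+1), a != 0 /\ E \in frames A a%:M.
Proof.
move=> /andP[/eqP At Au].
have [E|A0] := pickP (fun E : 'cV_n.+1 => (E^T *m A *m E) 0 0 != 0).
  by move=> a0; exists ((E^T *m A *m E) 0 0), E; rewrite inE -mx11_scalar.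
suff A00 : A = 0 by move: Au; rewrite A00 unitmxE det0 unitr0.
apply: quadratic_eq0 => // x.
by rewrite [LHS]mx11_scalar (eqP (negbFE (A0 x))) raddf0.
Qed.

(** An anisotropic vector spans a line with form [a], and [B] is the form on its complement; [y] is
    the coordinate along the line. *)
Lemma npts_split n (A : 'M[F]_n.+1) : symunit A -> exists a (B : 'M[F]_n),
  [/\ a != 0, symunit B, eta (\det B) = eta (a * \det A) &
      forall c, npts A c = (\sum_y npts B (c - a * y ^+ 2)%R)%N].
Proof.
move=> Asu; have [a [E [a0 EA]]] := exists_anisotropic Asu.
have au : (a%:M : 'M[F]_1) \in unitmx by rewrite unitmxE det_scalar1 unitfE.
have [X [Xu _ PAP Bsu Bd]] := @frame_complement 1 n A _ E Asu au EA.
exists a, (X^T *m A *m X); split=> // [|c].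
  by rewrite Bd det_scalar1 mulrC.
rewrite /npts -(card_frames_congr _ _ Xu) PAP.
rewrite -sum1_card (partition_big (fun x => usubmx x 0 0) predT) //=.
apply: eq_bigr => y _; rewrite sum1dep_card.
have injy : injective (fun z : 'cV[F]_n => col_mx (y%:M : 'M_1) z).
  by move=> z z' /eq_col_mx[].
rewrite -(card_imset _ injy); apply: eq_card => x; rewrite !inE.
have key (z : 'cV[F]_n) : (col_mx y%:M z \in
    frames (block_mx a%:M 0 0 (X^T *m A *m X)) (c%:M : 'M_1)) =
    (z \in frames (X^T *m A *m X) ((c - a * y ^+ 2)%:M : 'M_1)).
  rewrite !inE tr_col_mx tr_scalar_mx mul_row_block !mulmx0 addr0 add0r mul_row_col.
  rewrite -!scalar_mxM raddfB /= [RHS]eq_sym subr_eq [LHS]eq_sym addrC.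
  by congr (_ == _ + _%:M); ring.
apply/andP/imsetP => [[xc /eqP yx]|[z zc ->]].
  have xE : x = col_mx y%:M (dsubmx x).
    by rewrite -yx -mx11_scalar vsubmxK.
  by exists (dsubmx x) => //; rewrite -key -xE inE.
by move: zc; rewrite -key inE => ->; rewrite col_mxKu mxE eqxx.
Qed.

Let sgn_neq0 m : (-1) ^+ m != 0 :> F.
Proof. by rewrite expf_neq0 // oppr_eq0 oner_neq0. Qed.

Lemma symunit_det_neq0 n (A : 'M[F]_n) : symunit A -> \det A != 0.
Proof. by case/andP=> _; rewrite unitmxE unitfE. Qed.

Lemma npts_size1 (A : 'M[F]_1) c : symunit A -> (npts A c)%:Z = 1 + eta (c * \det A).
Proof.
move/symunit_det_neq0; rewrite [A]mx11_scalar det_scalar1; move: (A 0 0) => a a0.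
rewrite mulrC -card_scaled_sqrt //; congr _%:Z.
have injs : injective (fun y : F => y%:M : 'M_1).
  by move=> y z /matrixP/(_ 0 0); rewrite !mxE eqxx !mulr1n.
rewrite -(card_imset _ injs); apply: eq_card => E; rewrite inE.
have key y : ((y%:M : 'M_1)^T *m a%:M *m y%:M == c%:M :> 'M_1) = (a * y ^+ 2 == c).
  by rewrite tr_scalar_mx -!scalar_mxM (inj_eq injs); congr (_ == _); ring.
apply/idP/imsetP => [|[y]].
  by rewrite [E]mx11_scalar key => Ec; exists (E 0 0); rewrite ?inE.
by rewrite inE -key => yc ->.
Qed.

(** The parities alternate: by [npts_split], each follows from the other in one dimension less, the
    even case through [sum_quadchar_conic] and the odd one through [sum_fiber_weight]. *)
Lemma npts_formula m :
  (forall (A : 'M[F]_m.*2.+1) c, symunit A -> (npts A c)%:Z =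
     q ^+ m.*2 + eta ((-1) ^+ m * (c * \det A)) * q ^+ m) /\
  (forall (A : 'M[F]_m.*2.+2) c, symunit A -> (npts A c)%:Z =
     q ^+ m.*2.+1 + nu c * eta ((-1) ^+ m.+1 * \det A) * q ^+ m).
Proof.
have oddeven k : (forall (A : 'M[F]_k.*2.+1) c, symunit A -> (npts A c)%:Z =
     q ^+ k.*2 + eta ((-1) ^+ k * (c * \det A)) * q ^+ k) ->
  forall (A : 'M[F]_k.*2.+2) c, symunit A -> (npts A c)%:Z =
     q ^+ k.*2.+1 + nu c * eta ((-1) ^+ k.+1 * \det A) * q ^+ k.
  move=> IH A c Asu; have [a [B [a0 Bsu Bd ->]]] := npts_split Asu.
  have B0 := symunit_det_neq0 Bsu; have A0 := symunit_det_neq0 Asu.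
  pose s := (-1) ^+ k * \det B.
  have s0 : s != 0 by rewrite mulf_neq0.
  rewrite (big_morph Posz PoszD (erefl _)) (eq_bigr (fun y => q ^+ k.*2 +
      eta (s * c - (s * a) * y ^+ 2) * q ^+ k)) => [|y _]; last first.
    rewrite IH //; congr (_ + eta _ * _); rewrite /s; ring.
  rewrite big_split /= sumr_const -mulr_suml sum_quadchar_conic ?mulf_neq0 //.
  rewrite -mulr_natr natz -exprSr; congr (_ + _ * _ * _).
    by rewrite /fiber_weight mulf_eq0 (negPf s0).
  have -> : - (s * a) = ((-1) ^+ k.+1 * a) * \det B by rewrite /s exprS; ring.
  rewrite quadcharM // Bd -quadcharM // -[RHS](quadcharMsqr _ a0); congr eta; ring.
elim: m => [|m [_ IH]].
  by split; [|apply: oddeven] => A c Asu; rewrite npts_size1 // expr0 mul1r mulr1.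
suff odd_case (A : 'M[F]_m.+1.*2.+1) c : symunit A -> (npts A c)%:Z =
    q ^+ m.+1.*2 + eta ((-1) ^+ m.+1 * (c * \det A)) * q ^+ m.+1.
  by split=> //; apply: oddeven.
move=> Asu; have [a [B [a0 Bsu Bd ->]]] := npts_split Asu.
rewrite (big_morph Posz PoszD (erefl _)) (eq_bigr (fun y => q ^+ m.*2.+1 +
    nu (c - a * y ^+ 2) * (eta ((-1) ^+ m.+1 * \det B) * q ^+ m))) => [|y _];
  last by rewrite IH // mulrA.
rewrite big_split /= sumr_const -mulr_suml sum_fiber_weight //.
rewrite -mulr_natr natz -exprSr; congr (_ + _).
have -> : eta ((-1) ^+ m.+1 * (c * \det A)) =
    eta (a * c) * eta ((-1) ^+ m.+1 * \det B).
  rewrite [in RHS](quadcharM oddF _ (\det B)) Bd -!quadcharM //.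
  rewrite -[LHS](quadcharMsqr _ a0); congr eta; ring.
rewrite [q ^+ m.+1]exprS; ring.
Qed.

Lemma card_frames_cons n p (A : 'M[F]_n.+1) f : symunit A ->
    (forall A' : 'M[F]_n, symunit A' -> eta (\det A') = eta (\det A) ->
       #|frames A' (1%:M : 'M_p)| = f) ->
  #|frames A (1%:M : 'M_p.+1)| = (npts A 1%R * f)%N.
Proof.
move=> Asu fP; rewrite -[p.+1]/(1 + p)%N scalar_mx_block.
apply: (@card_frames_block 1 n) => //; first exact: unitmx1.
by move=> A' A'su; rewrite det1 mulr1; apply: fP.
Qed.

Lemma card_field_gt1 : 1 < q.
Proof. by rewrite (_ : 1 = 1%:Z) // ltz_nat card_finNzRing_gt1. Qed.

Lemma card_field_gt0 : 0 < q.
Proof. exact: lt_trans ltr01 card_field_gt1. Qed.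

Lemma orthfact_gt0 n : 0 < orthfact q n.
Proof.
apply: prodr_gt0 => j _; rewrite mulr_gt0 ?exprn_gt0 ?card_field_gt0 //.
by rewrite subr_gt0 exprn_egt1 ?card_field_gt1.
Qed.

Lemma npts1_odd m (A : 'M[F]_m.*2.+1) : symunit A ->
  (npts A 1)%:Z = q ^+ m * (q ^+ m + eta ((-1) ^+ m * \det A)).
Proof.
move=> Asu; have [/(_ A 1 Asu) -> _] := npts_formula m.
have -> : q ^+ m.*2 = q ^+ m * q ^+ m by rewrite -addnn exprD.
by rewrite mul1r; ring.
Qed.

Lemma npts1_even m (A : 'M[F]_m.*2.+2) : symunit A ->
  (npts A 1)%:Z = q ^+ m * (q ^+ m.+1 - eta ((-1) ^+ m.+1 * \det A)).
Proof.
move=> Asu; have [_ /(_ A 1 Asu) ->] := npts_formula m.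
have -> : q ^+ m.*2.+1 = q ^+ m * q ^+ m.+1 by rewrite -addnn -addnS exprD.
rewrite /fiber_weight oner_eq0; ring.
Qed.

(** The first vector has q^(m+1) (q^(m+1) + e) choices and the second q^m (q^(m+1) - e). The sign e
    cancels in the product, so pairs of vectors are counted independently of the discriminant. *)
Lemma card_frames_cons2 m p (A : 'M[F]_m.*2.+3) (f : nat) : symunit A ->
    (forall A' : 'M[F]_m.*2.+1, symunit A' -> eta (\det A') = eta (\det A) ->
       #|frames A' (1%:M : 'M_p)| = f) ->
  #|frames A (1%:M : 'M_p.+2)|%:Z = q ^+ m.*2.+1 * (q ^+ m.*2.+2 - 1) * f%:Z.
Proof.
move=> Asu fP; pose e := eta ((-1) ^+ m.+1 * \det A).
have e2 : e * e = 1 by rewrite sqr_quadchar // mulf_neq0 // symunit_det_neq0.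
have g0 : 0 <= q ^+ m * (q ^+ m.+1 - e).
  rewrite mulr_ge0 ?exprn_ge0 ?(ltW card_field_gt0) // subr_ge0.
  apply: (@le_trans _ _ 1); last by rewrite exprn_ege1 ?(ltW card_field_gt1).
  by rewrite /e; case: (quadcharP oddF ((-1) ^+ m.+1 * \det A)).
rewrite (card_frames_cons (f := `|(q ^+ m * (q ^+ m.+1 - e))%R| * f)%N Asu).
  rewrite !PoszM gez0_abs // (npts1_odd (m := m.+1)) // -/e.
  have -> : q ^+ m.*2.+1 = q ^+ m * q ^+ m.+1 by rewrite -addnn -addnS exprD.
  have -> : q ^+ m.*2.+2 = q ^+ m.+1 * q ^+ m.+1 by rewrite -exprD addnn.
  by rewrite mulrA; congr (_ * _); rewrite -[in RHS]e2; ring.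
move=> A' A'su A'd.
rewrite (card_frames_cons (f := f) A'su) => [|A'' A''su A''d]; last first.
  by apply: fP; rewrite // A''d.
apply/eqP; rewrite -eqz_nat !PoszM npts1_even // quadcharM // A'd -quadcharM //.
by rewrite gez0_abs.
Qed.

Lemma card_frames_size0 n (A : 'M[F]_n) : #|frames A (1%:M : 'M_0)| = 1%N.
Proof.
rewrite (_ : frames _ _ = [set 0]) ?cards1 //.
by apply/setP => E; rewrite !inE [E]thinmx0 [_ *m _]thinmx0 [1%:M]thinmx0 !eqxx.
Qed.

Lemma card_frames_odd n k (A : 'M[F]_n.*2.+1) : symunit A -> (k <= n)%N ->
  #|frames A (1%:M : 'M_k.*2)|%:Z * orthfact q (n - k) = orthfact q n.
Proof.
move=> Asu kn.
(* [f] is chosen before the form, since the inductive step needs one count for all complements. *)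
have [f] : exists f : nat, f%:Z * orthfact q (n - k) = orthfact q n /\
   forall A : 'M[F]_n.*2.+1, symunit A -> #|frames A (1%:M : 'M_k.*2)| = f.
  elim: k n {A Asu} kn => [|k IH] [|n] //= kn.
  - by exists 1%N; rewrite mul1r; split=> // A _; apply: card_frames_size0.
  - by exists 1%N; rewrite mul1r; split=> // A _; apply: card_frames_size0.
  have [f [fH fA]] := IH n kn.
  exists (`|(q ^+ n.*2.+1 * (q ^+ n.*2.+2 - 1))%R| * f)%N.
  have g0 : 0 <= q ^+ n.*2.+1 * (q ^+ n.*2.+2 - 1).
    rewrite mulr_ge0 ?exprn_ge0 ?(ltW card_field_gt0) // subr_ge0.
    by rewrite exprn_ege1 ?(ltW card_field_gt1).
  split=> [|A Asu].
    rewrite PoszM gez0_abs // subSS -mulrA fH mulrC.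
    by rewrite [RHS]big_ord_recr.
  apply/eqP; rewrite -eqz_nat PoszM gez0_abs //; apply/eqP.
  by apply: card_frames_cons2 => // A' A'su _; apply: fA.
by case=> <- /(_ A Asu) ->.
Qed.

(** For positive [k], one unit vector leads to odd dimension, where a square discriminant gives
    twice [orthfact] because the last line has two unit vectors. The factor on the left completes
    q^k - e to q^(2k) - 1. *)
Lemma card_frames_even k (A : 'M[F]_k.*2) : symunit A -> eta (\det A) = 1 ->
  #|frames A (1%:M : 'M_k.*2)|%:Z * (q ^+ k * (q ^+ k + eta ((-1) ^+ k))) =
  orthfact q k *+ 2.
Proof.
case: k A => [|k] A Asu Ad.
  have e1 : eta 1 = 1 by rewrite -[1](expr1n _ 2) quadchar_sqr ?oner_neq0.
  by rewrite card_frames_size0 /orthfact big_ord0 !expr0 e1.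
have [f [fH fA]] : exists f : nat, f%:Z = orthfact q k *+ 2 /\
   forall A : 'M[F]_k.*2.+1, symunit A -> eta (\det A) = 1 ->
      #|frames A (1%:M : 'M_k.*2.+1)| = f.
  elim: k {A Asu Ad} => [|k [f [fH fA]]].
    exists 2%N; split; first by rewrite /orthfact big_ord0.
    move=> A Asu Ad; apply/eqP; rewrite -eqz_nat -/(npts A 1) npts_size1 //.
    by rewrite mul1r Ad.
  exists (`|(q ^+ k.*2.+1 * (q ^+ k.*2.+2 - 1))%R| * f)%N.
  have g0 : 0 <= q ^+ k.*2.+1 * (q ^+ k.*2.+2 - 1).
    rewrite mulr_ge0 ?exprn_ge0 ?(ltW card_field_gt0) // subr_ge0.
    by rewrite exprn_ege1 ?(ltW card_field_gt1).
  split=> [|A Asu Ad].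
    by rewrite PoszM gez0_abs // fH mulrnAr mulrC [in RHS]/orthfact big_ord_recr.
  apply/eqP; rewrite -eqz_nat PoszM gez0_abs //; apply/eqP.
  by apply: card_frames_cons2 => // A' A'su A'd; apply: fA; rewrite // A'd.
rewrite (card_frames_cons (f := f) Asu) => [|A' A'su A'd]; last first.
  by apply: fA; rewrite // A'd.
rewrite PoszM fH npts1_even // quadcharM // Ad mulr1.
have e2 : eta ((-1) ^+ k.+1) * eta ((-1) ^+ k.+1) = 1 by rewrite sqr_quadchar.
rewrite [in RHS]/orthfact big_ord_recr /= -/(orthfact q k).
have -> : q ^+ k.*2.+1 = q ^+ k * q ^+ k.+1 by rewrite -addnn -addnS exprD.
have -> : q ^+ k.*2.+2 = q ^+ k.+1 * q ^+ k.+1 by rewrite -exprD addnn.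
have sub1 (x : int) : x - 1 = x - eta ((-1) ^+ k.+1) * eta ((-1) ^+ k.+1).
  by rewrite e2.
rewrite sub1; ring.
Qed.

End Frames.

(** * Involutions of orthogonal groups *)

Section Involutions.
Variable F : finFieldType.
Hypothesis oddF : odd #|F|.

Local Notation q := (#|F|%:Z).
Local Notation eta := (@quadchar F).

Variables (N : nat) (A : 'M[F]_N).
Hypothesis Asu : symunit A.

Definition gram m (E : 'M[F]_(N, m)) := E^T *m A *m E.

(** When [gram E] is invertible, this is the [A]-orthogonal projection onto the column span of [E];
    [frame_involution] is then -1 on that span and 1 on its complement. *)
Definition frame_proj m (E : 'M[F]_(N, m)) : 'M[F]_N :=
  E *m invmx (gram E) *m E^T *m A.

Definition frame_involution m (E : 'M[F]_(N, m)) : 'M[F]_N :=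
  1%:M - 2 *: frame_proj E.

Let At : A^T = A. Proof. by case/andP: Asu => /eqP. Qed.
Let Au : A \in unitmx. Proof. by case/andP: Asu. Qed.

Lemma gram_tr m (E : 'M[F]_(N, m)) : (gram E)^T = gram E.
Proof. by rewrite /gram !trmx_mul trmxK At mulmxA. Qed.

Section OneFrame.
Variables (m : nat) (E : 'M[F]_(N, m)).
Hypothesis Gu : gram E \in unitmx.

Lemma frame_proj_mulE : frame_proj E *m E = E.
Proof.
have -> : frame_proj E *m E = E *m invmx (gram E) *m gram E.
  by rewrite /frame_proj /gram !mulmxA.
by rewrite mulmxKV.
Qed.

Lemma frame_proj_idem : frame_proj E *m frame_proj E = frame_proj E.
Proof. by rewrite {2 3}/frame_proj !mulmxA frame_proj_mulE. Qed.

Lemma frame_proj_adj : (frame_proj E)^T *m A = A *m frame_proj E.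
Proof. by rewrite /frame_proj !trmx_mul trmx_inv gram_tr trmxK At !mulmxA. Qed.

Lemma frame_involution_mulE : frame_involution E *m E = - E.
Proof.
rewrite mulmxBl mul1mx -scalemxAl frame_proj_mulE.
by rewrite -{1}[E]scale1r -scalerBl -scaleN1r; congr (_ *: _); ring.
Qed.

Lemma frame_involutionK : frame_involution E *m frame_involution E = 1%:M.
Proof.
rewrite {1}/frame_involution mulmxBl mul1mx -scalemxAl mulmxBr mulmx1.
rewrite -scalemxAr frame_proj_idem -{1}[frame_proj E]scale1r -scalerBl scalerA.
by rewrite /frame_involution -addrA -opprD -scalerDl (_ : 2 + _ = 0) ?scale0r ?subr0 //; ring.
Qed.

Lemma frame_involution_isom : (frame_involution E)^T *m A *m frame_involution E = A.
Proof.
have -> : (frame_involution E)^T *m A = A *m frame_involution E.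
  rewrite [(_ - _)^T]raddfB /= trmx1 [(_ *: _)^T]linearZ /=.
  by rewrite mulmxBl mul1mx -scalemxAl frame_proj_adj mulmxBr mulmx1 -scalemxAr.
by rewrite -mulmxA frame_involutionK mulmx1.
Qed.

Lemma row_free_frame : row_free E^T.
Proof.
by apply/row_freeP; exists (A *m E *m invmx (gram E)); rewrite !mulmxA mulmxV.
Qed.

Lemma frame_size_le : (m <= N)%N.
Proof. by have := row_free_frame; rewrite /row_free => /eqP <-; apply: rank_leq_col. Qed.

Lemma frame_involution_fixE p (x : 'M[F]_(N, p)) :
  (frame_involution E *m x == x) = (E^T *m A *m x == 0).
Proof.
rewrite mulmxBl mul1mx -scalemxAl -subr_eq0 addrC addKr oppr_eq0 scaler_eq0.
rewrite (negPf (two_neq0 oddF)) /=; apply/eqP/eqP => [|Ex].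
  move/(congr1 (mulmx (E^T *m A))); rewrite mulmx0 /frame_proj !mulmxA.
  by rewrite -/(gram E) mulmxV // mul1mx.
by rewrite /frame_proj -!mulmxA (mulmxA E^T) Ex !mulmx0.
Qed.

Lemma mxrank_sub_frame_involution : \rank (1%:M - frame_involution E) = m.
Proof.
have -> : 1%:M - frame_involution E = 2 *: frame_proj E.
  by rewrite opprD opprK addrA subrr add0r.
rewrite (mxrank_scale_nz _ (two_neq0 oddF)).
apply/eqP; rewrite eqn_leq; apply/andP; split.
  rewrite /frame_proj -!mulmxA; apply: leq_trans (mxrankM_maxl _ _) _.
  exact: rank_leq_col.
apply: leq_trans (mxrankM_maxl _ E).
by rewrite frame_proj_mulE -mxrank_tr (eqP row_free_frame).
Qed.

Lemma card_fixed_frames l : (m + l)%N = N -> exists B : 'M[F]_l,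
  [/\ symunit B, eta (\det B) = eta (\det A * \det (gram E)) &
    forall p (D' : 'M[F]_p),
      #|[set G in frames A D' | frame_involution E *m G == G]| = #|frames B D'|].
Proof.
move=> Nml; have EG : E \in frames A (gram E) by rewrite inE.
have [B [Bsu Bd BD]] := orthogonal_frames Nml Asu Gu EG.
exists B; split=> // p D'; rewrite -BD; apply: eq_card => G.
by rewrite !inE frame_involution_fixE.
Qed.

End OneFrame.

(** [E] is a basis of the image of h = 1 - g, the (-1)-eigenspace. In a rank factorization h = E R,
    the relation h^2 = 2h gives R E = 2, and self-adjointness of h gives
    [R^T *m gram E = 2 *: (A *m E)]. These make [gram E] invertible and determine [R]. *)
Lemma isometric_involution_frame (g : 'M[F]_N) :
  g^T *m A *m g = A -> g *m g = 1%:M ->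
  exists E : 'M[F]_(N, \rank (1%:M - g)),
    gram E \in unitmx /\ g = frame_involution E.
Proof.
move=> gA gg; set h := 1%:M - g.
have [E [R [E' [R' [hE E'E RR']]]]] : exists (E : 'M_(N, \rank h)) R E' R',
    [/\ h = E *m R, E' *m E = 1%:M & R *m R' = 1%:M].
  have /row_fullP[E' E'E] := col_base_full h.
  have /row_freeP[R' RR'] := row_base_free h.
  by exists (col_base h), (row_base h), E', R'; rewrite mulmx_base.
have gAE : g^T *m A = A *m g by rewrite -{2}gA -mulmxA gg mulmx1.
have hA : h^T *m A = A *m h.
  by rewrite [(_ - _)^T]raddfB /= trmx1 mulmxBl mul1mx mulmxBr mulmx1 gAE.
have hh : h *m h = 2 *: h.
  rewrite mulmxBl mul1mx mulmxBr mulmx1 gg.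
  by rewrite -[g - _]opprB opprK scaler_nat mulr2n.
have RE : R *m E = 2%:M.
  have : E *m R *m (E *m R) = 2 *: (E *m R) by rewrite -hE.
  move/(congr1 (fun M => E' *m M *m R')); rewrite -scalemxAr -scalemxAl.
  by rewrite !mulmxA E'E !mul1mx -!mulmxA RR' mulmx1 => ->; rewrite scalemx1.
have AE2 : 2 *: (A *m E) = R^T *m gram E.
  have : (E *m R)^T *m A *m E = A *m (E *m R) *m E by rewrite -hE hA.
  by rewrite trmx_mul -!mulmxA RE /gram -!mulmxA => ->; rewrite mul_mx_scalar -scalemxAr.
have ER' : E = E *m R *m R' by rewrite -mulmxA RR' mulmx1.
have two := two_neq0 oddF.
have Gu : gram E \in unitmx.
  suff : 2^-1 *: (E' *m invmx A *m R^T) *m gram E = 1%:M by case/mulmx1_unit.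
  rewrite -scalemxAl -[_ *m R^T *m _]mulmxA -AE2 -scalemxAr scalerA mulVf // scale1r.
  by rewrite -mulmxA mulKmx // E'E.
have RT : R^T = 2 *: (A *m E *m invmx (gram E)).
  by rewrite -[R^T](mulmxK Gu) -AE2 -scalemxAl.
exists E; split=> //.
rewrite /frame_involution /frame_proj.
have -> : 2 *: (E *m invmx (gram E) *m E^T *m A) = E *m R.
  rewrite -[R]trmxK RT [(_ *: _)^T]linearZ /= -scalemxAr !trmx_mul trmx_inv gram_tr At.
  by rewrite !mulmxA.
by rewrite -hE subKr.
Qed.

End Involutions.

(** In the basis made of [E] and its complement [X] the involution is diagonal, with [m] entries
    -1. *)
Lemma det_frame_involution (F : finFieldType) (oddF : odd #|F|) N m
    (A : 'M[F]_N) (E : 'M[F]_(N, m)) :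
  symunit A -> gram A E \in unitmx -> \det (frame_involution A E) = (-1) ^+ m.
Proof.
move=> Asu Gu; have mN := frame_size_le Gu.
move: A E Asu Gu; rewrite -(subnKC mN) => A E Asu Gu.
have EG : E \in frames A (gram A E) by rewrite inE.
have [X [Xu EX _ _ _]] := frame_complement Asu Gu EG.
have X0 : \det (row_mx E X) != 0 by rewrite -unitfE -unitmxE.
apply: (mulIf X0); rewrite -det_mulmx mul_mx_row frame_involution_mulE //.
have /eqP -> : frame_involution A E *m X == X by rewrite frame_involution_fixE // EX.
have -> : row_mx (- E) X = row_mx E X *m block_mx (- 1%:M) 0 0 1%:M.
  by rewrite mul_row_block !mulmx0 addr0 add0r mulmxN !mulmx1.
rewrite det_mulmx det_ublock det1 mulr1 mulrC; congr (_ * _).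
by rewrite -scaleN1r detZ det1 mulr1.
Qed.

(** * Orthonormal frames and their involutions *)

Section OrthonormalFrames.
Variable F : finFieldType.
Hypothesis oddF : odd #|F|.
Variables (N : nat) (A : 'M[F]_N).
Hypothesis Asu : symunit A.

Let At : A^T = A. Proof. by case/andP: Asu => /eqP. Qed.

Lemma gram1_frame_involution m (E : 'M[F]_(N, m)) : gram A E = 1%:M ->
  frame_involution A E = 1%:M - 2 *: (E *m E^T *m A).
Proof. by rewrite /frame_involution /frame_proj => ->; rewrite invmx1 mulmx1. Qed.

(** A frame [P] of [gram A E] is a change of basis that makes [E] orthonormal, and [frame_proj]
    depends only on the span. *)
Lemma orthonormalize_frame m (E : 'M[F]_(N, m)) :
    #|frames (gram A E) (1%:M : 'M_m)| != 0%N ->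
  exists E' : 'M[F]_(N, m), gram A E' = 1%:M /\
    frame_involution A E' = frame_involution A E.
Proof.
rewrite cards_eq0 => /set0Pn[P]; rewrite inE => /eqP PG.
have G1 : gram A (E *m P) = 1%:M by rewrite -PG /gram trmx_mul !mulmxA.
exists (E *m P); split=> //; rewrite gram1_frame_involution //.
have Gu : gram A E \in unitmx.
  by have [+ _] := mulmx1_unit PG; rewrite unitmx_mul => /andP[].
have PP : P *m P^T = invmx (gram A E).
  by rewrite -[LHS](mulmxK Gu) -(mulmxA P) (mulmx1C PG) mul1mx.
by rewrite /frame_involution /frame_proj -PP trmx_mul !mulmxA.
Qed.

(** Two orthonormal frames give the same involution exactly when they differ by an element of the
    orthogonal group of [1%:M], so all fibres have the same size. *)
Lemma card_frame_involutions m :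
  (#|[set frame_involution A E | E in frames A (1%:M : 'M_m)]| *
    #|frames (1%:M : 'M[F]_m) (1%:M : 'M_m)| = #|frames A (1%:M : 'M_m)|)%N.
Proof.
set J := [set _ | _ in _].
rewrite -[RHS]sum1_card (partition_big (frame_involution A (m := m)) (mem J)) /=; last first.
  by move=> E EA; apply/imsetP; exists E.
rewrite -sum_nat_const; apply: eq_bigr => g /imsetP[E0].
rewrite inE => /eqP E0A ->{g}; rewrite sum1dep_card.
have injE : {in frames (1%:M : 'M[F]_m) (1%:M : 'M_m) &, injective (mulmx E0)}.
  move=> P P' _ _ /(congr1 (mulmx (E0^T *m A))).
  by rewrite !mulmxA E0A !mul1mx.
rewrite -(card_in_imset injE); apply: eq_card => E; rewrite inE.
apply/imsetP/andP => [[P]|[]].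
  rewrite !inE mulmx1 => /eqP PP ->.
  have EPA : gram A (E0 *m P) = 1%:M.
    by rewrite /gram trmx_mul -!mulmxA (mulmxA E0^T) (mulmxA _ E0) E0A mul1mx.
  split; first exact/eqP.
  rewrite !gram1_frame_involution // trmx_mul !mulmxA -(mulmxA E0 P).
  by rewrite (mulmx1C PP) mulmx1.
rewrite inE => /eqP EA /eqP; rewrite !gram1_frame_involution //.
move/addrI/oppr_inj/(scalerI (two_neq0 oddF)) => EE.
have EP : E = E0 *m (E0^T *m A *m E).
  by rewrite !mulmxA -EE -!mulmxA (mulmxA E^T) EA mulmx1.
exists (E0^T *m A *m E) => //; rewrite inE mulmx1.
move: EP; rewrite !trmx_mul trmxK At -!mulmxA => <-.
by rewrite mulmxA EA.
Qed.

(** Let e_i and f_i be the columns of [E1] and [E2]. Since [h] negates e_i - f_i and fixes e_i +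
    f_i, it exchanges e_i and f_i. So h g h is the involution attached to [E2], and its product with
    [g] negates both halves. *)
Lemma frame_involution_split k (E1 E2 : 'M[F]_(N, k)) :
    gram A (row_mx E1 E2) = 1%:M ->
  [/\ gram A E1 = 1%:M, gram A (E1 - E2) \in unitmx &
   let g := frame_involution A E1 in let h := frame_involution A (E1 - E2) in
   frame_involution A (row_mx E1 E2) = g *m h *m g *m h].
Proof.
move=> G1; have := G1.
rewrite {1}/gram tr_row_mx mul_col_mx mul_col_row scalar_mx_block.
case/eq_block_mx => G11 G12 G21 G22.
have Gd : gram A (E1 - E2) = 2 *: 1%:M.
  rewrite /gram [(_ - _)^T]raddfB /= !mulmxBl !mulmxBr G11 G12 G21 G22.
  by rewrite subr0 sub0r opprK scaler_nat mulr2n.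
have Gu : gram A (E1 - E2) \in unitmx.
  by rewrite Gd scalemx1 unitmxE det_scalar unitrX // unitfE two_neq0.
split=> //=; set g := frame_involution A E1; set h := frame_involution A (E1 - E2).
have hE1 : h *m E1 = E2.
  rewrite mulmxBl mul1mx /frame_proj Gd -!scalemxAl -!mulmxA (mulmxA _ A).
  rewrite [(_ - _)^T]raddfB /= !mulmxBl G11 G21 subr0 mulmx1.
  rewrite scalemx1 invmx_scalar !mul_mx_scalar -scalerBr scalerA.
  by rewrite mulfV ?two_neq0 // scale1r opprB addrC subrK.
have hh : h *m h = 1%:M by apply: frame_involutionK.
have hA : h^T *m A *m h = A by apply: frame_involution_isom.
clearbody h; have ghA : h^T *m A = A *m h by rewrite -{2}hA -mulmxA hh mulmx1.
have hgh : h *m g *m h = 1%:M - 2 *: (E2 *m E2^T *m A).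
  rewrite /g gram1_frame_involution // mulmxBr mulmx1 mulmxBl hh; congr (_ - _).
  rewrite -scalemxAr -scalemxAl; congr (_ *: _).
  by rewrite -hE1 trmx_mul -!mulmxA ghA.
rewrite -(mulmxA g) -(mulmxA g) hgh /g !gram1_frame_involution //.
rewrite tr_row_mx mul_row_col mulmxBl mul1mx -scalemxAl mulmxBr mulmx1.
rewrite -scalemxAr -!mulmxA (mulmxA E1^T) (mulmxA _ E2) G12 mul0mx !mulmx0 scaler0.
by rewrite subr0 mulmxDl scalerDr opprD !addrA -!mulmxA addrAC.
Qed.

End OrthonormalFrames.

(** Induction on the number of moved points: composing with the transposition of [x] and [s x] fixes
    both, leaves an involution and flips the sign. *)
Lemma odd_perm_involution (T : finType) (s : {perm T}) : (s * s = 1)%g ->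
  exists2 c, #|[set x | s x != x]| = c.*2 & odd_perm s = odd c.
Proof.
have [k] := ubnP #|[set x | s x != x]|; elim: k s => // k IH s.
rewrite ltnS => sk ss.
have ssx x : s (s x) = x by rewrite -permM ss perm1.
have [x sx|s1] := pickP (fun x => s x != x); last first.
  exists 0%N; first by apply/eqP; rewrite cards_eq0; apply/eqP/setP => x; rewrite !inE s1.
  by rewrite (_ : s = 1%g) ?odd_perm1 //; apply/permP => x; rewrite perm1 (eqP (negbFE (s1 x))).
pose t := (tperm x (s x) * s)%g.
have tE y : t y = if (y == x) || (y == s x) then y else s y.
  rewrite permM; case: tpermP => [->|->|/eqP/negPf-> /eqP/negPf->] //.
  - by rewrite eqxx ssx.
  - by rewrite eqxx orbT.
have tt : (t * t = 1)%g.
  apply/permP => y; rewrite permM perm1 (tE y); case: ifP => [yx|/norP[yx ysx]].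
    by rewrite tE yx.
  by rewrite tE -{1}(ssx x) !(inj_eq perm_inj) (negPf ysx) (negPf yx) ssx.
have cardt : #|[set y | s y != y]| = (#|[set y | t y != y]|).+2.
  rewrite (cardsD1 x) inE sx (cardsD1 (s x)) !inE ssx sx eq_sym sx add1n addSn add0n.
  congr _.+2; apply: eq_card => y; rewrite !inE tE.
  by case: (y == x); case: (y == s x); rewrite /= ?eqxx.
have [|c cE oc] := IH t _ tt; first by move: sk; rewrite cardt; lia.
exists c.+1; first by rewrite cardt cE.
by rewrite /= -oc odd_mul_tperm eq_sym sx addTb negbK.
Qed.

(** The elements of [G] where [chi] is false form a subgroup, which contains all commutators since
    [addb] is commutative. *)
Lemma der1_additive_character (gT : finGroupType) (G : {group gT}) (chi : gT -> bool) :
  {in G &, forall g h, chi (g * h)%g = chi g (+) chi h} ->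
  {in (G^`(1))%g, forall g, chi g = false}.
Proof.
move=> chiM.
have chi1 : chi 1%g = false.
  by have := chiM 1%g 1%g (group1 G) (group1 G); rewrite mulg1; case: (chi _).
have chiV g : g \in G -> chi g^-1%g = chi g.
  move=> gG; have := chiM g^-1%g g (groupVr gG) gG.
  by rewrite mulVg chi1; case: (chi _); case: (chi _).
have H_group : group_set [set g in G | ~~ chi g].
  apply/group_setP; split=> [|g h]; first by rewrite inE group1 chi1.
  rewrite !inE => /andP[gG /negPf cg] /andP[hG /negPf ch].
  by rewrite groupM // chiM // cg ch.
suff /subsetP sub : (G^`(1) \subset Group H_group)%g.
  by move=> g /sub; rewrite inE => /andP[_ /negPf].
rewrite gen_subG; apply/subsetP => _ /imset2P[g h gG hG ->].
rewrite inE groupR //= /commg /conjg !chiM ?groupM ?groupV // !chiV //.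
by case: (chi g); case: (chi h).
Qed.

(** * Involutions of Omega(2n+1,q) *)

Section OddOrthogonalInvolutions.
Variables (n : nat) (F : finFieldType).
Hypothesis oddF : odd #|F|.

Local Notation q := (#|F|%:Z).
Local Notation eta := (@quadchar F).
Local Notation N := n.*2.+1.
Local Notation GL := {'GL_n.*2.+1[F]}.
Local Notation e := (fun i : 'I_N => delta_mx i 0 : 'cV[F]_N).

(** A sum of rank-one matrices, so that products with vectors read off coordinates; the halves come
    from symmetrizing the products of paired coordinates. *)
Definition odd_gram : 'M[F]_N :=
  \sum_(k < n) (2^-1 *: (e (inord k.*2) *m (e (inord k.*2.+1))^T
                       + e (inord k.*2.+1) *m (e (inord k.*2))^T))
  + e ord_max *m (e ord_max)^T.
Local Notation A := odd_gram.

Let eE (i : 'I_N) p (x : 'M[F]_(N, p)) : (e i)^T *m x = row i x.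
Proof. by rewrite trmx_delta -rowE. Qed.

Let e_coef (i : 'I_N) (x : 'cV[F]_N) : (e i)^T *m x = (x i 0)%:M.
Proof. by rewrite eE [LHS]mx11_scalar mxE. Qed.

Let coef_e (i : 'I_N) (x : 'cV[F]_N) : x^T *m e i = (x i 0)%:M.
Proof. by rewrite -[LHS]trmxK trmx_mul trmxK e_coef tr_scalar_mx. Qed.

Lemma odd_gramE x : x^T *m A *m x = (odd_qform x)%:M.
Proof.
rewrite /odd_gram mulmxDr mulmxDl mulmx_sumr mulmx_suml raddfD /= raddf_sum /=.
congr (_ + _); last by rewrite mulmxA coef_e -mulmxA e_coef -scalar_mxM.
apply: eq_bigr => k _; rewrite -scalemxAr -scalemxAl mulmxDr mulmxDl.
rewrite !mulmxA !coef_e -!mulmxA !e_coef -!scalar_mxM -raddfD /= scale_scalar_mx.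
congr _%:M; field; exact: two_neq0.
Qed.

Lemma odd_gram_sym : A^T = A.
Proof.
rewrite /odd_gram raddfD /= raddf_sum /= trmx_mul trmxK; congr (_ + _).
apply: eq_bigr => k _; rewrite [(_ *: _)^T]linearZ /= raddfD /= !trmx_mul !trmxK.
by rewrite addrC.
Qed.

Lemma odd_gram_symunit : symunit A.
Proof.
rewrite /symunit odd_gram_sym eqxx -unitmx_tr odd_gram_sym -row_free_unit.
rewrite -kermx_eq0; apply/rowV0P => z /sub_kermxP/(congr1 trmx).
rewrite trmx_mul odd_gram_sym trmx0 => Az.
suff ker_gram (x : 'cV[F]_N) : A *m x = 0 -> x = 0.
  by rewrite -[z]trmxK (ker_gram _ Az) trmx0.
move=> {z Az}Ax.
have entry (i : 'I_N) : \sum_(k < n) 2^-1 * ((i == inord k.*2)%:R * x (inord k.*2.+1) 0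
    + (i == inord k.*2.+1)%:R * x (inord k.*2) 0) + (i == ord_max)%:R * x ord_max 0 = 0.
  transitivity ((A *m x) i 0); last by rewrite Ax mxE.
  rewrite /odd_gram mulmxDl mulmx_suml [in RHS]mxE summxE; congr (_ + _).
    apply: eq_bigr => k _; rewrite -scalemxAl mxE mulmxDl mxE.
    rewrite -!mulmxA !e_coef !mul_mx_scalar !mxE !eqxx !andbT.
    by rewrite [X in _ * (X + _)]mulrC [X in _ * (_ + X)]mulrC.
  by rewrite -mulmxA e_coef mul_mx_scalar !mxE eqxx andbT mulrC.
have two := two_neq0 oddF.
have inord_eq (i : 'I_N) m : (m < N)%N -> (i == inord m) = (i == m :> nat).
  by move=> mN; rewrite -val_eqE /= inordK.
apply/matrixP => i j; rewrite ord1 [RHS]mxE {j}.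
have := ltn_ord i; rewrite ltnS leq_eqVlt => /predU1P[iM|iM].
  have := entry i; rewrite big1 => [|k _]; last first.
    have kn : (k < n)%N := ltn_ord k; rewrite !inord_eq; try lia.
    have [-> ->] : (i == k.*2 :> nat) = false /\ (i == k.*2.+1 :> nat) = false.
      by split; lia.
    by rewrite !mul0r addr0 mulr0.
  have -> : i = ord_max by apply: val_inj.
  by rewrite eqxx mul1r add0r.
have kn : (i./2 < n)%N by lia.
(* [i'] is the partner of [i] in its hyperbolic pair: the only nonzero entry in row [i'] of
   [odd_gram] is [2^-1] in column [i]. *)
pose i' : 'I_N := inord (if odd i then i.-1 else i.+1).
have i'E : i' = (if odd i then i.-1 else i.+1) :> nat by rewrite inordK //; case: ifP => oi; lia.
have := entry i'; rewrite (bigD1 (Ordinal kn)) //= big1 => [|k kNi]; last first.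
  have kn' : (k < n)%N := ltn_ord k; move: kNi; rewrite -val_eqE /= => kNi.
  rewrite !inord_eq ?i'E; try lia.
  have [-> ->] : ((if odd i then i.-1 else i.+1) == k.*2) = false /\
      ((if odd i then i.-1 else i.+1) == k.*2.+1) = false.
    by split; case: ifP => oi; lia.
  by rewrite !mul0r addr0 mulr0.
rewrite addr0 !inord_eq ?i'E; try lia.
rewrite (_ : (i' == ord_max) = false) ?mul0r ?addr0; last first.
  by rewrite -val_eqE /= i'E; case: ifP => oi; lia.
have xi m : m = i :> nat -> x (inord m) 0 = x i 0.
  by move=> ->; rewrite inord_val.
case: ifP => oi.
  have [-> ->] : (i.-1 == i./2.*2) = true /\ (i.-1 == i./2.*2.+1) = false by split; lia.
  rewrite mul1r mul0r addr0 => /eqP; rewrite mulf_eq0 invr_eq0 (negPf two) /= => /eqP.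
  by rewrite xi //; lia.
have [-> ->] : (i.+1 == i./2.*2) = false /\ (i.+1 == i./2.*2.+1) = true by split; lia.
rewrite mul1r mul0r add0r => /eqP; rewrite mulf_eq0 invr_eq0 (negPf two) /= => /eqP.
by rewrite xi //; lia.
Qed.

Local Notation gm g := (GLval g : 'M[F]_N).

Lemma odd_GOE (g : GL) : (g \in odd_GO n F) = ((gm g)^T *m A *m gm g == A).
Proof.
rewrite inE; apply/forallP/eqP => [gQ|gA x].
  apply/eqP; rewrite -subr_eq0; apply/eqP/(quadratic_eq0 oddF) => [|x].
    by rewrite raddfB /= !trmx_mul trmxK odd_gram_sym mulmxA.
  rewrite mulmxBr mulmxBl odd_gramE -(eqP (gQ x)) -odd_gramE trmx_mul !mulmxA.
  exact: subrr.
apply/eqP; have := odd_gramE (gm g *m x); rewrite trmx_mul -!mulmxA.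
rewrite (mulmxA A) (mulmxA (gm g)^T) (mulmxA (gm g)^T A) gA mulmxA odd_gramE.
by move/matrixP/(_ 0 0); rewrite !mxE eqxx !mulr1n.
Qed.

(** The default 1 is taken only for singular [M]. *)
Definition GL_of_mx (M : 'M[F]_N) : GL := insubd (1%g : GL) M.

Lemma GL_of_mxK M : M \in unitmx -> gm (GL_of_mx M) = M.
Proof. by move=> Mu; have := insubdK (1%g : GL) Mu. Qed.

Lemma GL_mxM (g h : GL) : gm (g * h)%g = gm g *m gm h.
Proof. by rewrite GL_ME. Qed.

Lemma GL_mx_inj : injective (fun g : GL => gm g).
Proof. exact: val_inj. Qed.

Lemma mem_odd_SO (M : 'M[F]_N) : M^T *m A *m M = A -> \det M = 1 ->
  gm (GL_of_mx M) = M /\ GL_of_mx M \in odd_SO n F.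
Proof.
move=> MA M1; have Mu : M \in unitmx by rewrite unitmxE M1 unitr1.
have MK := GL_of_mxK Mu; split=> //.
by rewrite inE odd_GOE MK MA eqxx; apply/eqP.
Qed.

Lemma odd_Omega_frame k (E : 'M[F]_(N, k.*2)) : gram A E = 1%:M ->
  exists2 g, g \in odd_Omega n F & gm g = frame_involution A E.
Proof.
move: E; rewrite -(addnn k) => E; rewrite -[E]hsubmxK.
move: (lsubmx E) (rsubmx E) => E1 E2 {E} EA.
have Asu := odd_gram_symunit.
have [E1A Edu gE] := frame_involution_split oddF Asu EA.
have E1u : gram A E1 \in unitmx by rewrite E1A unitmx1.
(* The two involutions have determinant [s]. Scaling by [s] makes it 1, as the dimension is odd, and
   the scalars cancel in the commutator, where each factor occurs twice. *)
pose s : F := (-1) ^+ k.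
have ss : s * s = 1 by rewrite -expr2 sqrr_sign.
have so (g : 'M[F]_N) : g^T *m A *m g = A -> g *m g = 1%:M -> \det g = s ->
    let a := GL_of_mx (s *: g) in
    [/\ gm a = s *: g, a \in odd_SO n F & (a * a = 1)%g].
  move=> gA gg dg a; have [||aE aSO] := @mem_odd_SO (s *: g).
  - by rewrite [(_ *: _)^T]linearZ /= -!scalemxAl -scalemxAr scalerA ss scale1r.
  - by rewrite detZ dg -exprSr -[n.*2.+2]/(n.+1.*2) -muln2 mulnC exprM expr2 ss expr1n.
  split=> //; apply: GL_mx_inj; rewrite GL_mxM aE -scalemxAl -scalemxAr gg.
  by rewrite scalerA ss scale1r.
have [] := so (frame_involution A E1).
- exact: frame_involution_isom.
- exact: frame_involutionK.
- exact: det_frame_involution.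
move: (GL_of_mx _) => a aE aSO aa.
have [] := so (frame_involution A (E1 - E2)).
- exact: frame_involution_isom.
- exact: frame_involutionK.
- exact: det_frame_involution.
move: (GL_of_mx _) => b bE bSO bb.
exists [~ a, b]%g; first exact: mem_commg.
have aV : (a^-1 = a)%g by apply/eqP; rewrite eq_invg_mul aa.
have bV : (b^-1 = b)%g by apply/eqP; rewrite eq_invg_mul bb.
rewrite /commg /conjg aV bV !GL_mxM aE bE gE /= -!scalemxAl -!scalemxAr !scalerA.
by rewrite !mulmxA ss mul1r ss scale1r.
Qed.

(** Extending the action on the sphere {Q = 1} by the identity gives a permutation of all vectors
    with the same sign. *)
Definition sphere_act (g : GL) (x : 'cV[F]_N) :=
  if x \in frames A (1%:M : 'M_1) then gm g *m x else x.

(* The default value [1] is only taken when [g] is not an isometry. *)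
Definition sphere_perm (g : GL) : {perm 'cV[F]_N} :=
  odflt 1%g [pick s : {perm 'cV[F]_N} | [forall x, s x == sphere_act g x]].

Let sphere_stable (g : GL) (x : 'cV[F]_N) : g \in odd_GO n F ->
  (gm g *m x \in frames A (1%:M : 'M_1)) = (x \in frames A (1%:M : 'M_1)).
Proof.
rewrite odd_GOE => /eqP gA.
by rewrite !inE trmx_mul -!mulmxA (mulmxA A) (mulmxA (gm g)^T) (mulmxA (gm g)^T A) gA.
Qed.

Lemma sphere_permE g x : g \in odd_GO n F -> sphere_perm g x = sphere_act g x.
Proof.
move=> gO; rewrite /sphere_perm; case: pickP => [s /forallP/(_ x)/eqP //|no].
have act_inj : injective (sphere_act g).
  move=> y z; rewrite /sphere_act.
  have gu : gm g \in unitmx by apply: (valP g).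
  case: ifP => yS; case: ifP => zS // yz.
  - exact: can_inj (mulKmx gu) _ _ yz.
  - by rewrite -yz sphere_stable // yS in zS.
  - by rewrite yz sphere_stable // zS in yS.
by have := no (perm act_inj); case: forallP => // h _; case: h => y; rewrite permE.
Qed.

(** The order is reversed because permutations compose from left to right while matrices act on
    columns from the left; signs are not affected. *)
Lemma sphere_permM : {in odd_GO n F &, forall g h,
  sphere_perm (g * h)%g = (sphere_perm h * sphere_perm g)%g}.
Proof.
move=> g h gO hO; apply/permP => x; rewrite permM !sphere_permE ?groupM //.
rewrite /sphere_act GL_mxM; case: ifP => xS; last by rewrite xS.
by rewrite sphere_stable // xS mulmxA.
Qed.

Let Omega_SO g : g \in odd_Omega n F -> g \in odd_SO n F.
Proof. by apply: subsetP; apply: der_sub. Qed.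

Let SO_GO g : g \in odd_SO n F -> g \in odd_GO n F.
Proof. by rewrite inE => /andP[]. Qed.

(** The sign of the permutation is trivial on the derived subgroup, so [g] acts as an even number of
    disjoint transpositions, and the number of moved points is a multiple of 4. *)
Lemma odd_Omega_fixed_points g : g \in odd_Omega n F -> (g ^+ 2 = 1)%g ->
  npts A 1 = #|[set x in frames A (1%:M : 'M_1) | gm g *m x == x]| %[mod 4].
Proof.
move=> gW g2; have gO := SO_GO (Omega_SO gW).
have even_g : odd_perm (sphere_perm g) = false.
  apply: (der1_additive_character (G := odd_SO_group n F)
    (chi := fun g => odd_perm (sphere_perm g))) gW.
  by move=> a b aO bO; rewrite sphere_permM ?SO_GO // odd_permM addbC.
have sq : (sphere_perm g * sphere_perm g = 1)%g.
  rewrite -sphere_permM // -[(g * g)%g]/(g ^+ 2)%g g2.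
  apply/permP => x; rewrite sphere_permE ?group1 // perm1 /sphere_act.
  by rewrite GL_1E mul1mx if_same.
have [c cE] := odd_perm_involution sq; rewrite even_g => /esym/negbT oc.
rewrite /npts -(cardsID [set x | gm g *m x == x]).
have -> : #|frames A (1%:M : 'M_1) :\: [set x | gm g *m x == x]| = c.*2.
  rewrite -cE; apply: eq_card => x; rewrite !inE sphere_permE // /sphere_act inE.
  by case: ifP => _; rewrite ?andbT ?andbF ?eqxx.
have -> : c.*2 = ((c./2) * 4)%N by lia.
rewrite addnC modnMDl; congr (modn _ 4); apply: eq_card => x.
by rewrite !inE.
Qed.

Let odd_gram_det0 m (E : 'M[F]_(N, m)) : gram A E \in unitmx -> \det (gram A E) != 0.
Proof. by rewrite unitmxE unitfE. Qed.

Lemma frames_odd_gram_exist k : (k <= n)%N ->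
  exists E : 'M[F]_(N, k.*2), gram A E = 1%:M.
Proof.
move=> kn; have := card_frames_odd oddF odd_gram_symunit kn.
have [->|[E]] := set_0Vmem (frames A (1%:M : 'M_k.*2)); last first.
  by rewrite inE => /eqP EA _; exists E.
rewrite cards0 mul0r => H0; have := orthfact_gt0 F n.
by rewrite -H0 ltxx.
Qed.

(** [g] is compared with the element [g1] of Omega attached to an orthonormal frame of the same
    size. Their fixed points on the sphere are the unit vectors of complements of dimension 2l+1. If
    the discriminants differed, the two counts would be q^l (q^l + 1) and q^l (q^l - 1), whose
    difference 2 q^l is not divisible by 4. *)
Lemma odd_Omega_gram k (E : 'M[F]_(N, k.*2)) g : gram A E \in unitmx ->
  g \in odd_Omega n F -> gm g = frame_involution A E -> eta (\det (gram A E)) = 1.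
Proof.
move=> Gu gW gE; have Asu := odd_gram_symunit.
have A0 := symunit_det_neq0 Asu.
have kn : (k <= n)%N by have := frame_size_le Gu; lia.
have [E1 G1] := frames_odd_gram_exist kn.
have G1u : gram A E1 \in unitmx by rewrite G1 unitmx1.
have [g1 g1W g1E] := odd_Omega_frame G1.
have sq (h : GL) k' (H : 'M[F]_(N, k')) : gram A H \in unitmx ->
    gm h = frame_involution A H -> (h ^+ 2 = 1)%g.
  move=> Hu hH; apply: GL_mx_inj; rewrite [(h ^+ 2)%g]/(h * h)%g GL_mxM hH.
  by rewrite frame_involutionK // GL_1E.
have := odd_Omega_fixed_points gW (sq _ _ _ Gu gE).
rewrite (odd_Omega_fixed_points g1W (sq _ _ _ G1u g1E)) gE g1E.
pose l := (n - k)%N; have kl : (k.*2 + l.*2.+1)%N = N by rewrite /l; lia.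
have [B [Bsu Bd ->]] := card_fixed_frames oddF Asu Gu kl.
have [B1 [B1su B1d ->]] := card_fixed_frames oddF Asu G1u kl.
rewrite -/(npts B 1) -/(npts B1 1).
have := npts1_odd oddF Bsu; have := npts1_odd oddF B1su.
rewrite !quadcharM // Bd B1d G1 det1 mulr1 quadcharM //.
have [->//|->] := quadchar_opts oddF (odd_gram_det0 Gu).
have [||] := @quadchar_opts _ oddF ((-1) ^+ l * \det A).
- by rewrite mulf_neq0 // expf_neq0 // oppr_eq0 oner_neq0.
all: rewrite quadcharM // => sE; rewrite mulrA sE.
all: rewrite mulrN1 mulrDr mulrDr.
all: have oQ : odd (#|F| ^ l) by rewrite oddX oddF orbT.
all: have QE : q ^+ l = (#|F| ^ l)%N by rewrite -[RHS]natz natrX natz.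
all: rewrite QE; move: (npts B 1) (npts B1 1) (#|F| ^ l)%N oQ => x x1 Q oQ.
all: rewrite -PoszM; move: (Q * Q)%N => QQ; lia.
Qed.

Definition odd_Omega_involutions k : {set GL} :=
  [set g in odd_Omega n F | (g ^+ 2 == 1)%g & \rank (1%:M - gm g) == k.*2].

Lemma odd_Omega_involutionsE k :
  [set gm (g : GL) | g in odd_Omega_involutions k] =
  [set frame_involution A E | E in frames A (1%:M : 'M_k.*2)].
Proof.
have Asu := odd_gram_symunit.
apply/setP => M; apply/imsetP/imsetP => [[g]|[E]].
  rewrite inE => /and3P[gW /eqP g2 /eqP rg ->{M}].
  have gO := SO_GO (Omega_SO gW).
  have gg : gm g *m gm g = 1%:M by rewrite -GL_mxM -[(g * g)%g]/(g ^+ 2)%g g2 GL_1E.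
  move: gO; rewrite odd_GOE => /eqP gA.
  have := isometric_involution_frame oddF Asu gA gg.
  rewrite rg => [[E [Eu gE]]].
  have e1 := odd_Omega_gram Eu gW gE.
  have Gsu : symunit (gram A E) by rewrite /symunit gram_tr // eqxx.
  (* A Gram matrix of square determinant admits an orthonormal basis; otherwise [card_frames_even]
     would equate 0 with a positive number. *)
  have [|E' [E'1 E'E]] := orthonormalize_frame (A := A) (E := E).
    apply/eqP => f0; have := card_frames_even oddF Gsu e1.
    rewrite f0 mul0r => H0; have := orthfact_gt0 F k.
    by rewrite -(pmulrn_lgt0 _ (isT : (0 < 2)%N)) -H0 ltxx.
  by exists E'; rewrite ?inE ?E'E //; apply/eqP.
rewrite inE => /eqP EA ->{M}.
have Eu : gram A E \in unitmx by rewrite [gram A E]EA unitmx1.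
have [g gW gE] := odd_Omega_frame EA.
exists g => //; rewrite inE gW gE mxrank_sub_frame_involution // eqxx andbT.
apply/eqP/GL_mx_inj; rewrite [(g ^+ 2)%g]/(g * g)%g GL_mxM gE GL_1E.
exact: frame_involutionK.
Qed.

Lemma card_odd_Omega_involutions k : (k <= n)%N ->
  #|odd_Omega_involutions k|%:Z * (orthfact q k *+ 2 * orthfact q (n - k)) =
  q ^+ k * (q ^+ k + eta ((-1) ^+ k)) * orthfact q n.
Proof.
move=> kn; rewrite -(card_frames_odd oddF odd_gram_symunit kn).
rewrite -card_frame_involutions //; last exact: odd_gram_symunit.
rewrite -odd_Omega_involutionsE card_imset; last exact: GL_mx_inj.
have e1 : eta (\det (1%:M : 'M[F]_k.*2)) = 1.
  by rewrite det1 -[1](expr1n _ 2) quadchar_sqr ?oner_neq0.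
have I1 : symunit (1%:M : 'M[F]_k.*2) by rewrite /symunit trmx1 eqxx unitmx1.
rewrite -(card_frames_even oddF I1 e1) PoszM; ring.
Qed.

Lemma num_sq1_odd_Omega :
  num_sq1 (odd_Omega n F) = (\sum_(k < n.+1) #|odd_Omega_involutions k|)%N.
Proof.
have Asu := odd_gram_symunit.
have rank_even g : g \in odd_Omega n F -> (g ^+ 2 = 1)%g ->
    exists2 k, (k <= n)%N & \rank (1%:M - gm g) = k.*2.
  move=> gW g2; have := Omega_SO gW; rewrite inE odd_GOE => /andP[/eqP gA /eqP dg].
  have gg : gm g *m gm g = 1%:M by rewrite -GL_mxM -[(g * g)%g]/(g ^+ 2)%g g2 GL_1E.
  have [E [Eu gE]] := isometric_involution_frame oddF Asu gA gg.
  move: E Eu gE; move: (\rank _) => r E Eu gE.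
  (* An odd [r] would give determinant -1, which differs from 1 in odd characteristic. *)
  have := frame_size_le Eu; have := det_frame_involution oddF Asu Eu.
  rewrite -gE dg -signr_odd; case: (boolP (odd r)) => [_ /eqP|ro _ rN].
    by rewrite expr1 -subr_eq0 opprK (negPf (two_neq0 oddF)).
  by exists r./2; lia.
rewrite /num_sq1 -sum1_card.
rewrite (partition_big (fun g : GL => inord (\rank (1%:M - gm g))./2 : 'I_n.+1) predT) //=.
apply: eq_bigr => k _; rewrite sum1dep_card; apply: eq_card => g; rewrite !inE.
case gW: (g \in odd_Omega n F) => //=; case: eqP => //= g2.
have [r rn rE] := rank_even g gW g2.
by rewrite rE doubleK -val_eqE /= inordK // -(inj_eq double_inj).
Qed.
End OddOrthogonalInvolutions.

(** * The limit *)

From mathcomp Require Import all_classical all_reals all_analysis.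

Import numFieldNormedType.Exports.
Local Open Scope classical_set_scope.
Local Open Scope ring_scope.

(** * Finite q-Pochhammer products *)

Section QPochhammer.
Variables (R : realType) (y : R).

Definition qpoch (y : R) n := \prod_(i < n) (1 - y ^+ i.+1).

Lemma qpoch0 z : qpoch z 0 = 1. Proof. by rewrite /qpoch big_ord0. Qed.

Lemma qpochS z n : qpoch z n.+1 = qpoch z n * (1 - z ^+ n.+1).
Proof. by rewrite /qpoch big_ord_recr. Qed.

Hypotheses (y_gt0 : 0 < y) (y_le : y <= 3^-1).

Let y_lt1 : y < 1. Proof. by apply: le_lt_trans y_le _; rewrite invf_lt1 // ltr1n. Qed.

Lemma qpoch_ge n : 2^-1 <= qpoch y n.
Proof.
(* The extra term makes the bound inductive: with z = y^n the step needs 2 y z + y z^2 <= z, which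
   follows from y <= 1/3 and z <= 1. *)
suff h : 2^-1 + 2^-1 * y ^+ n <= qpoch y n.
  apply: le_trans h; rewrite lerDl mulr_ge0 ?invr_ge0 ?exprn_ge0 ?ltW //.
elim: n => [|n IH]; first by rewrite qpoch0 expr0; lra.
rewrite qpochS; have yn0 : 0 < y ^+ n by apply: exprn_gt0.
have yn1 : y ^+ n <= 1 by apply: exprn_ile1; rewrite ?ltW.
have h1 : 0 <= 1 - y ^+ n.+1 by rewrite subr_ge0 exprn_ile1 ?ltW.
apply: le_trans (ler_wpM2r h1 IH); rewrite exprS.
set z := y ^+ n in yn0 yn1 *.
have yz : y * z * z <= 3^-1 * z.
  have z0 := ltW yn0; have zz : z * z <= z by rewrite ler_piMr.
  by rewrite -mulrA; apply: ler_pM; rewrite ?mulr_ge0 // ltW.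
have : y * z <= 3^-1 * z by rewrite ler_wpM2r // ltW.
nra.
Qed.

Lemma qpoch_gt0 n : 0 < qpoch y n.
Proof. by apply: lt_le_trans (qpoch_ge n); rewrite invr_gt0 ltr0n. Qed.

Lemma qpoch_le1 n : qpoch y n <= 1.
Proof.
elim: n => [|n IH]; first by rewrite qpoch0.
rewrite qpochS mulr_ile1 ?(ltW (qpoch_gt0 n)) //.
  by rewrite subr_ge0 exprn_ile1 ?ltW.
by rewrite gerBl exprn_ge0 ?ltW.
Qed.

Lemma is_cvg_qpoch : cvgn (qpoch y).
Proof.
apply: nonincreasing_is_cvgn.
  apply/nonincreasing_seqP => n; rewrite qpochS ler_piMr ?(ltW (qpoch_gt0 n)) //.
  by rewrite gerBl exprn_ge0 ?ltW.
by exists 2^-1 => _ [n _ <-]; apply: qpoch_ge.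
Qed.

Lemma lim_qpoch_gt0 : 0 < limn (qpoch y).
Proof.
apply: (@lt_le_trans _ _ 2^-1); first by rewrite invr_gt0 ltr0n.
apply: limr_ge; first exact: is_cvg_qpoch.
by apply: nearW => n; apply: qpoch_ge.
Qed.

End QPochhammer.

Section QProducts.
Variable R : realType.

Definition qplus (y : R) n := \prod_(i < n) (1 + y ^+ i.+1).

Lemma qplusM_qpoch (y : R) n : qplus y n * qpoch y n = qpoch (y ^+ 2) n.
Proof.
rewrite /qplus /qpoch -big_split /=; apply: eq_bigr => i _.
by rewrite -exprM mulnC exprM; ring.
Qed.

(** The exponents 1, ..., 2n are split by parity; this gives access to the product over odd
    exponents. *)
Lemma qplus_double (y : R) n :
  qplus y n.*2 = \prod_(i < n) (1 + y ^+ i.*2.+1) * qplus (y ^+ 2) n.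
Proof.
elim: n => [|n IH]; first by rewrite /qplus !big_ord0 mulr1.
rewrite doubleS /qplus !big_ord_recr /= -/(qplus y n.*2) IH /qplus.
by rewrite -exprM mul2n doubleS; ring.
Qed.
End QProducts.

(** A Toeplitz argument: beyond some [K] the values [u k] are small and the total weight is at most
    [C], while each of the first [K] terms tends to 0. Dividing by [|C| + 1] avoids a zero
    denominator. *)
Lemma toeplitz_cvg0 (R : realType) (w : nat -> nat -> R) (C : R) (u : R^nat) :
    (forall n k, 0 <= w n k) -> (forall n, \sum_(k < n.+1) w n k <= C) ->
    (forall k, w n k @[n --> \oo] --> (0 : R)) -> u @ \oo --> (0 : R) ->
  \sum_(k < n.+1) w n k * u k @[n --> \oo] --> (0 : R).
Proof.
move=> w0 wC wcvg ucvg; apply/cvgrPdist_le => eps eps0.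
have C0 : 0 < `|C| + 1 by rewrite ltr_wpDl.
pose d := eps / 2 / (`|C| + 1).
have d0 : 0 < d by rewrite !divr_gt0.
have /cvgrPdist_le/(_ _ d0)[K _ uK] := ucvg.
have {}uK k : (K <= k)%N -> `|u k| <= d.
  by move=> Kk; have := uK k Kk; rewrite sub0r normrN.
have head : \sum_(k < K) w n k * `|u k| @[n --> \oo] --> (0 : R).
  rewrite [X in _ --> X](_ : 0 = \sum_(k < K) 0 * `|u k|); last first.
    by rewrite big1 // => k _; rewrite mul0r.
  apply: cvg_big; [exact: add_continuous|] => k _; apply: cvgM; [exact: wcvg | exact: cvg_cst].
have e2 : 0 < eps / 2 by rewrite divr_gt0.
have /cvgrPdist_le/(_ _ e2) headn := head.
near=> n; rewrite sub0r normrN.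
have hn : \sum_(k < K) w n k * `|u k| <= eps / 2.
  have : `|0 - \sum_(k < K) w n k * `|u k| | <= eps / 2 by near: n.
  rewrite sub0r normrN ger0_norm // sumr_ge0 // => k _.
  by rewrite mulr_ge0.
have Kn : (K <= n.+1)%N by apply: leqW; near: n; exists K.
apply: le_trans (ler_norm_sum _ _ _) _.
apply: (@le_trans _ _ (\sum_(k < n.+1) (w n k * d + (if (k < K)%N then w n k * `|u k| else 0)))).
  apply: ler_sum => k _; rewrite normrM (ger0_norm (w0 _ _)).
  have [kK|Kk] := ltnP k K; first by rewrite lerDr mulr_ge0 // ltW.
  by rewrite addr0 ler_wpM2l // uK.
rewrite big_split /= -mulr_suml -big_mkcond /=.
rewrite (big_ord_widen _ (fun k => w n k * `|u k|) Kn) in hn *.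
rewrite [eps]splitr lerD //.
apply: (@le_trans _ _ ((`|C| + 1) * d)).
  rewrite ler_wpM2r ?(ltW d0) // (le_trans (wC n)) // (le_trans (ler_norm C)) //.
  by rewrite lerDl.
by rewrite /d mulrCA divff ?mulr1 // gt_eqF.
Unshelve. all: by end_near.
Qed.

Lemma cvgn_ext (R : realType) (f g : R^nat) (a b : R) :
  f @ \oo --> a -> f =1 g -> a = b -> g @ \oo --> b.
Proof. by move=> fa /funext <- <-. Qed.

(** * The weights and the limit of their sum *)

Section Weights.
Variables (R : realType) (x : R).
Hypothesis x_ge3 : 3 <= x.

Let x_gt0 : 0 < x. Proof. by apply: lt_le_trans x_ge3; rewrite ltr0n. Qed.
Let x_gt1 : 1 < x. Proof. by apply: lt_le_trans x_ge3; rewrite ltr1n. Qed.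
Let xn_neq0 n : x ^+ n != 0. Proof. by rewrite expf_neq0 // gt_eqF. Qed.

Let p := (x ^+ 2)^-1.

Lemma sqrV_exp_gt0 m : 0 < p ^+ m.
Proof. by rewrite exprn_gt0 // invr_gt0 exprn_gt0. Qed.

Lemma sqrV_exp_le m : p ^+ m.+1 <= 3^-1.
Proof.
have p1 : p <= 3^-1.
  rewrite lef_pV2 ?posrE ?exprn_gt0 ?ltr0n // (le_trans x_ge3) //.
  by rewrite expr2 ler_peMr // ltW.
rewrite exprSr; apply: le_trans p1; rewrite ler_piMl ?(ltW (sqrV_exp_gt0 1)) //.
apply: exprn_ile1; first exact: ltW (sqrV_exp_gt0 1).
by rewrite invf_le1 ?exprn_gt0 // exprn_ege1 // ltW.
Qed.

Let exp_ratio a b c d : (a + d = c + b)%N -> x ^+ a / x ^+ b = x ^+ c / x ^+ d.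
Proof. by move=> e; apply/eqP; rewrite eqr_div // -!exprD e. Qed.

(** For [k <= n] and d = n - 2k this is x^(-d(d+1)), whence the concentration around k = n/2. *)
Definition weight n k := x ^+ (4 * k * (n - k) + 2 * k) / x ^+ (n ^ 2 + n).

Lemma weight_ge0 n k : 0 <= weight n k.
Proof. by rewrite divr_ge0 ?exprn_ge0 ?ltW. Qed.

(** With d = n - 2k, the exponents -d(d+1) at k and -d(d-1) at n - k are both at most 1 - d. *)
Lemma weight_le n k : (k <= n)%N ->
  weight n k <= geometric (x ^+ k.*2.+1) x^-1 n /\
  weight n (n - k) <= geometric (x ^+ k.*2.+1) x^-1 n.
Proof.
move=> kn; have [l ->] : exists l, n = (k + l)%N by exists (n - k)%N; lia.
have h a : (a + (k + l) <= k.*2.+1 + ((k + l) ^ 2 + (k + l)))%N ->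
    x ^+ a / x ^+ ((k + l) ^ 2 + (k + l)) <= geometric (x ^+ k.*2.+1) x^-1 (k + l)%N.
  move=> le_a; rewrite /geometric /= exprVn ler_pdivrMr ?exprn_gt0 // mulrAC.
  by rewrite ler_pdivlMr ?exprn_gt0 // -!exprD ler_weXn2l // ltW.
by split; apply: h; rewrite addKn ?addnK -mulnn; case: (leqP k l) => [|/ltnW] /subnKC <-; nia.
Qed.

Lemma cvg_weight_left k : weight n k @[n --> \oo] --> (0 : R).
Proof.
have : geometric (x ^+ k.*2.+1) x^-1 @ \oo --> (0 : R).
  by apply: cvg_geometric; rewrite ger0_norm ?invr_ge0 ?(ltW x_gt0) // invf_lt1.
apply: squeeze_cvgr (cvg_cst 0); exists k => // n /= kn.
by rewrite weight_ge0; have [] := weight_le kn.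
Qed.

Lemma cvg_weight_right k : weight n (n - k) @[n --> \oo] --> (0 : R).
Proof.
have : geometric (x ^+ k.*2.+1) x^-1 @ \oo --> (0 : R).
  by apply: cvg_geometric; rewrite ger0_norm ?invr_ge0 ?(ltW x_gt0) // invf_lt1.
apply: squeeze_cvgr (cvg_cst 0); exists k => // n /= kn.
by rewrite weight_ge0; have [] := weight_le kn.
Qed.

Definition gauss (y : R) n k :=
  if (k <= n)%N then qpoch y n / (qpoch y k * qpoch y (n - k)) else 0.

(** The exponent of x in [weight] is -4k^2 plus terms linear in k, as in y^(k(k-1)/2) for y = x^-8;
    this is the base for which the q-binomial theorem applies. *)
Let y := p ^+ 4.
Let y_gt0 : 0 < y. Proof. exact: sqrV_exp_gt0. Qed.
Let y_le : y <= 3^-1. Proof. exact: sqrV_exp_le. Qed.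
Let qpy n : qpoch y n != 0. Proof. by rewrite gt_eqF // qpoch_gt0. Qed.

Lemma gauss_pascal n k : (k <= n)%N ->
  gauss y n.+1 k.+1 = gauss y n k.+1 + y ^+ (n - k) * gauss y n k.
Proof.
move=> kn; rewrite /gauss ltnS kn subSS.
have [l nE] : exists l, n = (k + l)%N by exists (n - k)%N; lia.
rewrite nE; case: l nE => [|l] nE.
  rewrite addn0 ltnn subnn expr0 qpoch0 !mulr1 mul1r add0r.
  by rewrite !divff.
have -> : (k < k + l.+1)%N by lia.
have -> : (k + l.+1 - k = l.+1)%N by lia.
have -> : (k + l.+1 - k.+1 = l)%N by lia.
have ne m : 1 - y ^+ m.+1 != 0.
  by have := qpy m.+1; rewrite qpochS mulf_eq0 => /norP[].
rewrite !qpochS -[(k + l.+1).+1]addSn exprD.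
by field; rewrite !ne !qpy.
Qed.

Let gauss0 n : gauss y n 0 = 1.
Proof. by rewrite /gauss subn0 qpoch0 mul1r divff. Qed.

Let gauss_rev n k : (k <= n)%N -> gauss y n (n - k) = gauss y n k.
Proof. by move=> kn; rewrite /gauss kn leq_subr subKn // [_ * qpoch y k]mulrC. Qed.

Lemma sum_gauss_weight n :
  \sum_(k < n.+1) gauss y n k * weight n k = \prod_(i < n) (1 + p ^+ i.*2.+1).
Proof.
elim: n => [|n IH].
  by rewrite big_ord1 big_ord0 gauss0 /weight !muln0 expr0 divr1 mul1r.
rewrite [RHS]big_ord_recr /= -IH (reindex_inj rev_ord_inj) /=.
(* Read backwards, the weights of level n+1 fit the Pascal rule: its first term returns the weights
   of level [n] ([vk]), its second the same weights times [p ^+ n.*2.+1] ([vSk]). *)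
pose v k := weight n.+1 (n.+1 - k).
have vk k : (k <= n)%N -> v k = weight n k.
  move=> kn; rewrite /v; have [l ->] : exists l, n = (k + l)%N by exists (n - k)%N; lia.
  rewrite /weight; have -> : ((k + l).+1 - k = l.+1)%N by lia.
  have -> : ((k + l).+1 - l.+1 = k)%N by lia.
  by rewrite addKn; apply: exp_ratio; nia.
have vSk k : (k <= n)%N -> y ^+ (n - k) * v k.+1 = weight n k * p ^+ n.*2.+1.
  move=> kn; rewrite /v; have [l ->] : exists l, n = (k + l)%N by exists (n - k)%N; lia.
  rewrite /weight subSS addKn; have -> : ((k + l).+1 - l = k.+1)%N by lia.
  rewrite /y /p -!exprM !exprVn -!exprM mulrC -!mulrA -!invfM -!exprD.
  by apply: exp_ratio; rewrite -!mul2n; nia.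
transitivity (\sum_(k < n.+2) gauss y n.+1 k * v k).
  by apply: eq_bigr => k _; rewrite subSS gauss_rev // -ltnS ltn_ord.
rewrite big_ord_recl gauss0 /=.
rewrite (eq_bigr (fun k : 'I_n.+1 => gauss y n k.+1 * v k.+1 +
    y ^+ (n - k) * gauss y n k * v k.+1)) => [|k _]; last first.
  by rewrite /bump /= add1n gauss_pascal ?mulrDl // -ltnS.
rewrite big_split /= addrA mulrDr mulr1; congr (_ + _).
  rewrite -(gauss0 n) -(big_ord_recl n.+1 (fun k : 'I_n.+2 => gauss y n k * v k)) /=.
  rewrite big_ord_recr /= [gauss y n n.+1]/gauss ltnn mul0r addr0.
  by apply: eq_bigr => k _; rewrite vk // -ltnS.
rewrite mulr_suml; apply: eq_bigr => k _.
have kn : (k <= n)%N by rewrite -ltnS.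
by rewrite [y ^+ _ * _]mulrC -mulrA (vSk _ kn) mulrA.
Qed.

Let qp_ge m n : 2^-1 <= qpoch (p ^+ m.+1) n.
Proof. exact: qpoch_ge (sqrV_exp_gt0 _) (sqrV_exp_le _) n. Qed.
Let qp_gt0 m n : 0 < qpoch (p ^+ m.+1) n.
Proof. exact: qpoch_gt0 (sqrV_exp_gt0 _) (sqrV_exp_le _) n. Qed.
Let qp_le1 m n : qpoch (p ^+ m.+1) n <= 1.
Proof. exact: qpoch_le1 (sqrV_exp_gt0 _) (sqrV_exp_le _) n. Qed.

Let phi m := limn (qpoch (p ^+ m)).

Let qp_cvg m : qpoch (p ^+ m.+1) @ \oo --> phi m.+1.
Proof. exact: is_cvg_qpoch (sqrV_exp_gt0 _) (sqrV_exp_le _). Qed.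

Let phi_neq0 m : phi m.+1 != 0.
Proof. by rewrite gt_eqF //; exact: lim_qpoch_gt0 (sqrV_exp_gt0 _) (sqrV_exp_le _). Qed.

Let qpV_cvg m : (qpoch (p ^+ m.+1) n)^-1 @[n --> \oo] --> (phi m.+1)^-1.
Proof. by apply: cvgV => //; exact: qp_cvg. Qed.

Let qpV_bounds m n : 0 <= (qpoch (p ^+ m.+1) n)^-1 <= 2.
Proof.
rewrite invr_ge0 ltW //= -[leRHS]invrK lef_pV2 ?posrE ?invr_gt0 ?ltr0n //.
Qed.

Let qplusE m n : qplus (p ^+ m.+1) n = qpoch (p ^+ (m.+1).*2) n / qpoch (p ^+ m.+1) n.
Proof. by rewrite -muln2 exprM -qplusM_qpoch mulfK // gt_eqF. Qed.

Lemma qplus_cvg m : qplus (p ^+ m.+1) @ \oo --> phi (m.+1).*2 / phi m.+1.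
Proof.
rewrite (_ : qplus _ = fun n => qpoch (p ^+ (m.+1).*2) n / qpoch (p ^+ m.+1) n).
  apply: cvgM; [exact: (@qp_cvg (m.*2.+1)) | exact: qpV_cvg].
by apply/funext => n; exact: qplusE.
Qed.

Let oddplus n := \prod_(i < n) (1 + p ^+ i.*2.+1).

Let qplus_ge1 m n : 1 <= qplus (p ^+ m) n.
Proof.
rewrite /qplus; elim/big_ind: _ => // [a b|i _]; first exact: mulr_ege1.
by rewrite lerDl exprn_ge0 // ltW // sqrV_exp_gt0.
Qed.

Let oddplusE n : oddplus n = qplus p n.*2 / qplus (p ^+ 2) n.
Proof. by rewrite qplus_double mulfK // gt_eqF // (lt_le_trans ltr01). Qed.

Let double_infty : (fun n => n.*2) @ \oo --> \oo.
Proof.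
move=> A [N _ NA]; exists N => // n /= Nn; apply: NA => /=; lia.
Qed.

Let oddplus_cvg : oddplus @ \oo --> (phi 2 / phi 1) / (phi 4 / phi 2).
Proof.
rewrite (_ : oddplus = fun n => qplus (p ^+ 1) n.*2 / qplus (p ^+ 2) n); last first.
  by apply/funext => n; rewrite oddplusE expr1.
apply: cvgM; first exact: cvg_comp double_infty (@qplus_cvg 0).
apply: cvgV; last exact: (@qplus_cvg 1).
by rewrite mulf_neq0 ?invr_eq0.
Qed.

(** The denominator in [oddplusE] is at least 1, and the numerator is a quotient of [qpoch] values,
    at most 1 over at least 1/2. *)
Let oddplus_le2 n : oddplus n <= 2.
Proof.
rewrite oddplusE ler_pdivrMr ?(lt_le_trans ltr01) //.
apply: (@le_trans _ _ 2); last by rewrite ler_peMr.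
rewrite -[p]expr1 qplusE -[leRHS]mul1r; apply: ler_pM => //.
- exact: ltW (@qp_gt0 1 _).
- by have /andP[] := qpV_bounds 0 n.*2.
- exact: (@qp_le1 1).
- by have /andP[] := qpV_bounds 0 n.*2.
Qed.

Local Notation wt := weight.

Let gaussE n k : (k <= n)%N -> gauss (p ^+ 4) n k =
  qpoch (p ^+ 4) n * ((qpoch (p ^+ 4) k)^-1 * (qpoch (p ^+ 4) (n - k))^-1).
Proof. by move=> kn; rewrite /gauss kn invfM. Qed.

(** Every Gaussian coefficient here is at least 1/2, so the sum is at most twice the product in
    [sum_gauss_weight]. *)
Lemma weight_sum_le n : \sum_(k < n.+1) wt n k <= 4.
Proof.
apply: (@le_trans _ _ (2 * oddplus n)); last first.
  by rewrite (_ : 4 = 2 * 2) ?ler_wpM2l //; ring.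
rewrite /oddplus -(sum_gauss_weight) mulr_sumr; apply: ler_sum => k _.
have kn : (k <= n)%N by rewrite -ltnS.
have gauss_ge : 2^-1 <= gauss (p ^+ 4) n k.
  rewrite gaussE // -[leLHS]mulr1; apply: ler_pM; rewrite ?invr_ge0 ?ler0n ?ler01 //.
  have qV m : 1 <= (qpoch (p ^+ 4) m)^-1.
    by rewrite invf_ge1; [exact: (@qp_le1 3) | exact: (@qp_gt0 3)].
  by apply: mulr_ege1.
by rewrite mulrA ler_peMl ?weight_ge0 // -ler_pdivrMl // mulr1.
Qed.

Let weight_sum_rev (f : nat -> nat -> R) n :
  \sum_(k < n.+1) f k (n - k)%N = \sum_(k < n.+1) f (n - k)%N k.
Proof.
rewrite (reindex_inj rev_ord_inj) /=; apply: eq_bigr => k _.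
by rewrite subSS subKn // -ltnS.
Qed.

(** Write b_k c_(n-k) - B C = C (b_k - B) + b_k (c_(n-k) - C). The weights vanish in the limit at
    both ends, so [toeplitz_cvg0] handles the first part directly and the second after reversal,
    with the bounded b_k absorbed into the weights. *)
Lemma weighted_product_cvg (b c : R^nat) (B C M : R) :
    (forall k, 0 <= b k <= M) -> b @ \oo --> B -> c @ \oo --> C ->
  \sum_(k < n.+1) wt n k * (b k * c (n - k)%N)
    - B * C * \sum_(k < n.+1) wt n k @[n --> \oo] --> (0 : R).
Proof.
move=> bM bB cC.
have bB0 : (fun k => b k - B) @ \oo --> (0 : R).
  by rewrite -(subrr B); apply: cvgB => //; apply: cvg_cst.
have cC0 : (fun k => c k - C) @ \oo --> (0 : R).
  by rewrite -(subrr C); apply: cvgB => //; apply: cvg_cst.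
have M0 : 0 <= M by have /andP[b0 bM0] := bM 0%N; apply: le_trans bM0.
have left0 := toeplitz_cvg0 (weight_ge0) weight_sum_le (cvg_weight_left) bB0.
have right0 : \sum_(k < n.+1) (wt n (n - k) * b (n - k)%N) * (c k - C) @[n --> \oo] --> (0 : R).
  apply: (@toeplitz_cvg0 _ (fun n k => wt n (n - k) * b (n - k)%N) (4 * M)
    (fun k => c k - C)) => //.
  - by move=> n k; rewrite mulr_ge0 ?weight_ge0 //; have /andP[] := bM (n - k)%N.
  - move=> n; rewrite -(weight_sum_rev (fun k _ => wt n k * b k)).
    apply: le_trans (ler_wpM2r M0 (weight_sum_le n)); rewrite mulr_suml.
    apply: ler_sum => k _; rewrite ler_wpM2l ?weight_ge0 //.
    by have /andP[] := bM k.
  - move=> k; have lim0 : wt n (n - k) * M @[n --> \oo] --> (0 : R).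
      by rewrite -(mul0r M); apply: cvgM; [exact: cvg_weight_right | exact: cvg_cst].
    apply: (squeeze_cvgr _ (cvg_cst 0) lim0); apply: nearW => n.
    have /andP[b0 bMn] := bM (n - k)%N.
    by rewrite mulr_ge0 ?weight_ge0 //= ler_wpM2l ?weight_ge0.
apply: cvgn_ext (cvgD (cvgM (cvg_cst C) left0) right0) _ _ => [n /=|]; last first.
  by rewrite mulr0 addr0.
rewrite -[LHS]/(C * (\sum_(k < n.+1) wt n k * (b k - B)) +
  \sum_(k < n.+1) wt n (n - k) * b (n - k)%N * (c k - C)).
have /= <- := weight_sum_rev (fun k j => wt n k * b k * (c j - C)) n.
rewrite !mulr_sumr -big_split -sumrB /=; apply: eq_bigr => k _; ring.
Qed.

(** With both sequences equal to the inverse of [qpoch (p ^+ 4)], the sum [S n] has a known limit by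
    [sum_gauss_weight], and it is asymptotic to the sum of weights divided by [phi 4 ^+ 2]. Solving
    for the latter gives the limit. *)
Let W_cvg : \sum_(k < n.+1) wt n k @[n --> \oo] --> phi 2 ^+ 2 / phi 1.
Proof.
have b_cvg := @qpV_cvg 3.
have D_cvg := weighted_product_cvg (qpV_bounds 3) b_cvg b_cvg.
pose S n := \sum_(k < n.+1) wt n k * ((qpoch (p ^+ 4) k)^-1 * (qpoch (p ^+ 4) (n - k))^-1).
have SE n : S n = oddplus n * (qpoch (p ^+ 4) n)^-1.
  rewrite /oddplus -(sum_gauss_weight) mulr_suml; apply: eq_bigr => k _.
  have kn : (k <= n)%N by rewrite -ltnS.
  have qp0 : qpoch (p ^+ 4) n != 0 by rewrite gt_eqF //; exact: (@qp_gt0 3).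
  rewrite gaussE // -[_ * _ * wt n k]mulrA [RHS]mulrAC mulfV // mul1r.
  exact: mulrC.
have S_cvg : S @ \oo --> (phi 2 / phi 1) / (phi 4 / phi 2) / phi 4.
  rewrite (funext SE); exact: cvgM oddplus_cvg b_cvg.
apply: cvgn_ext (cvgM (cvg_cst (phi 4 ^+ 2)) (cvgB S_cvg D_cvg)) _ _ => [n /=|].
  rewrite -[LHS]/(phi 4 ^+ 2 * (S n -
    (S n - (phi 4)^-1 / phi 4 * \sum_(k < n.+1) wt n k))).
  by field; rewrite phi_neq0.
by rewrite subr0; field; rewrite !phi_neq0.
Qed.

(** The factor [x ^- k] damps [e k], so boundedness suffices. The weighted products average to
    [(phi 1) ^- 2], the weights sum to [phi 2 ^+ 2 / phi 1] in the limit, and the prefactor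
    contributes [phi 1 / 2]. *)
Lemma involution_sum_cvg (e : nat -> R) : (forall k, `|e k| <= 1) ->
  2^-1 * qpoch p n * \sum_(k < n.+1) wt n k *
    ((1 + e k * x ^- k) / qpoch p k * (qpoch p (n - k))^-1) @[n --> \oo]
  --> 2^-1 * (phi 2 / phi 1) ^+ 2.
Proof.
move=> e1; rewrite -[p]expr1.
have xk k : 0 <= x ^- k <= 1.
  rewrite invr_ge0 exprn_ge0 ?(ltW x_gt0) //=.
  by rewrite invf_le1 ?exprn_gt0 // exprn_ege1 // ltW.
have ex_bound k : - 1 <= e k * x ^- k <= 1.
  rewrite -ler_norml normrM; have /andP[x0 x1] := xk k.
  by rewrite (ger0_norm x0) mulr_ile1.
have e_cvg : (fun k => 1 + e k * x ^- k) @ \oo --> (1 : R).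
  rewrite -[X in _ --> X]addr0; apply: cvgD; first exact: cvg_cst.
  have xV_cvg : (fun k => x ^- k) @ \oo --> (0 : R).
    have : geometric 1 x^-1 @ \oo --> (0 : R).
      by apply: cvg_geometric; rewrite ger0_norm ?invr_ge0 ?(ltW x_gt0) // invf_lt1.
    by rewrite (_ : geometric 1 _ = fun k => x ^- k) //; apply/funext => k;
      rewrite /geometric /= mul1r exprVn.
  have xVN_cvg : (fun k => - x ^- k) @ \oo --> (0 : R) by rewrite -oppr0; apply: cvgN.
  apply: squeeze_cvgr xVN_cvg xV_cvg; apply: nearW => k.
  have /andP[x0 x1] := xk k; rewrite -ler_norml normrM (ger0_norm x0).
  by rewrite ler_piMl.
have b_cvg : (fun k => (1 + e k * x ^- k) / qpoch (p ^+ 1) k) @ \oo --> 1 / phi 1.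
  exact: cvgM e_cvg (@qpV_cvg 0).
have b_bound k : 0 <= (1 + e k * x ^- k) / qpoch (p ^+ 1) k <= 4.
  have /andP[h1 h2] := ex_bound k; have /andP[h3 h4] := qpV_bounds 0 k.
  by apply/andP; split; nra.
have D_cvg := weighted_product_cvg b_bound b_cvg (@qpV_cvg 0).
pose K := 1 / phi 1 * (phi 1)^-1; pose W n := \sum_(k < n.+1) wt n k.
pose S n := \sum_(k < n.+1) wt n k *
  ((1 + e k * x ^- k) / qpoch (p ^+ 1) k * (qpoch (p ^+ 1) (n - k))^-1).
have lim : (fun n => 2^-1 * qpoch (p ^+ 1) n * (S n - K * W n + K * W n)) @ \oo -->
    2^-1 * phi 1 * (0 + K * (phi 2 ^+ 2 / phi 1)).
  apply: cvgM; first by apply: cvgM; [exact: cvg_cst | exact: (@qp_cvg 0)].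
  by apply: cvgD; [exact: D_cvg | apply: cvgM; [exact: cvg_cst | exact: W_cvg]].
apply: cvgn_ext lim _ _ => [n|]; first by rewrite subrK.
by rewrite /K add0r; field; rewrite phi_neq0.
Qed.

End Weights.

(** The exponent 2 m^2 + m is the dimension of SO(2m+1). *)
Lemma orthfact_qpoch (R : realType) (x : R) m : x != 0 ->
  orthfact x m = x ^+ (2 * m ^ 2 + m) * qpoch (x ^+ 2)^-1 m.
Proof.
move=> x0; elim: m => [|m IH]; first by rewrite /orthfact big_ord0 qpoch0 mulr1.
rewrite /orthfact big_ord_recr /= -/(orthfact x m) IH qpochS.
have -> : (2 * m.+1 ^ 2 + m.+1 = (2 * m ^ 2 + m) + (m.*2.+1 + m.*2.+2))%N by rewrite -!mulnn; nia.
have -> : (x ^+ 2)^-1 ^+ m.+1 = (x ^+ m.*2.+2)^-1 by rewrite exprVn -exprM mul2n.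
by rewrite !exprD; field; rewrite expf_neq0.
Qed.

(** The dimension of SO(2n+1) exceeds the sum of those for k and n - k by 4k(n-k), and
    [x ^+ k * (x ^+ k + e)] adds 2k: this is the numerator of [weight]. The powers are generalized
    to leave [field] with independent variables. *)
Lemma involution_term (R : realType) (x I e : R) n k : x != 0 ->
    (forall m, qpoch (x ^+ 2)^-1 m != 0) -> (k <= n)%N ->
    I * (orthfact x k *+ 2 * orthfact x (n - k)) =
      x ^+ k * (x ^+ k + e) * orthfact x n ->
  2^-1 * qpoch (x ^+ 2)^-1 n * (weight x n k *
    ((1 + e * x ^- k) / qpoch (x ^+ 2)^-1 k * (qpoch (x ^+ 2)^-1 (n - k))^-1)) =
  I / x ^+ (n ^ 2 + n).
Proof.
move=> x0 qp0 /subnKC <-; move: (n - k)%N => l; rewrite /weight addKn !orthfact_qpoch //.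
have -> : (2 * (k + l) ^ 2 + (k + l) =
    (2 * k ^ 2 + k) + (2 * l ^ 2 + l) + 4 * k * l)%N by rewrite -!mulnn; nia.
have x2k : x ^+ (2 * k) = x ^+ k * x ^+ k by rewrite mul2n -addnn exprD.
rewrite [x ^+ (4 * k * l + _)]exprD x2k.
move: (2 * k ^ 2)%N (2 * l ^ 2)%N (4 * k * l)%N ((k + l) ^ 2)%N => i1 i2 i3 i4.
rewrite !exprD; have xn0 m : x ^+ m != 0 by rewrite expf_neq0.
move: (xn0 i1) (xn0 i2) (xn0 k) (xn0 l) (xn0 i3) (xn0 i4) (qp0 k) (qp0 l).
move: (x ^+ i1) (x ^+ i2) (x ^+ k) (x ^+ l) (x ^+ i3) (x ^+ i4).
move: (qpoch _ k) (qpoch _ l) (qpoch _ (k + l)) => Qk Ql Q a b c d f g a0 b0 c0 d0 f0 g0 Qk0 Ql0 IE.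
have -> : I = c * (c + e) * (a * c * (b * d) * f * Q) / ((a * c * Qk) * (b * d * Ql)) / 2.
  apply: (canRL (mulfK _)); first by rewrite pnatr_eq0.
  apply: (canRL (mulfK _)); first by rewrite !mulf_neq0.
  by rewrite -IE; ring.
by field; rewrite a0 b0 c0 d0 g0 Qk0 Ql0.
Qed.

Theorem theorem7p5 (R : realType) (q : nat) (F : finFieldType)
    (hF : #|F| = q) (hq : odd q) :
  (num_sq1 (odd_Omega n F))%:R / (q%:R : R) ^+ (n ^ 2 + n) @[n --> \oo] -->
  2^-1 * limn (fun N : nat =>
    \prod_(1 <= i < N.+1) (1 + 1 / (q%:R : R) ^+ (2 * i)) ^+ 2).
Proof.
subst q; set x : R := #|F|%:R.
have x_ge3 : 3 <= x.
  by rewrite ler_nat; have := card_finNzRing_gt1 F; move: hq; case: #|F| => [|[|[|]]].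
have x_gt0 : 0 < x by apply: lt_le_trans x_ge3; rewrite ltr0n.
have x0 : x != 0 by rewrite gt_eqF.
set p := (x ^+ 2)^-1.
(* As 1 + p^i = (1 - p^(2i)) / (1 - p^i), the product is the square of a quotient of two Pochhammer
   limits. *)
have -> : limn (fun N : nat => \prod_(1 <= i < N.+1) (1 + 1 / x ^+ (2 * i)) ^+ 2) =
    (limn (qpoch (p ^+ 2)) / limn (qpoch (p ^+ 1))) ^+ 2.
  apply/cvg_lim => //.
  rewrite (_ : (fun N => _) = fun N => qplus (p ^+ 1) N ^+ 2).
    have qc : qplus (p ^+ 1) @ \oo -->
      limn (qpoch (p ^+ 2)) / limn (qpoch (p ^+ 1)) := @qplus_cvg _ _ x_ge3 0.
    by apply: cvgn_ext (cvgM qc qc) _ _ => [N|]; rewrite expr2.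
  apply/funext => N; rewrite big_add1 /= big_mkord prodrXl; congr (_ ^+ 2).
  by apply: eq_bigr => i _; rewrite expr1 div1r exprM exprVn.
pose e k : R := (quadchar ((-1) ^+ k : F))%:~R.
have e1 k : `|e k| <= 1.
  rewrite /e; have [||] := @quadchar_opts _ hq ((-1) ^+ k : F).
  - by rewrite expf_neq0 // oppr_eq0 oner_neq0.
  - by move=> ->; rewrite normr1.
  - by move=> ->; rewrite normrN1.
have := involution_sum_cvg x_ge3 e1.
apply: cvg_trans; apply: near_eq_cvg; apply: nearW => n.
rewrite num_sq1_odd_Omega // natr_sum mulr_sumr mulr_suml; apply: eq_bigr => k _.
have kn : (k <= n)%N by rewrite -ltnS.
have := card_odd_Omega_involutions hq kn.
move/(congr1 (fun z : int => z%:~R : R)).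
have H m : (orthfact #|F|%:Z m)%:~R = orthfact x m :> R.
  rewrite /orthfact rmorph_prod; apply: eq_bigr => i _.
  by rewrite rmorphM rmorphB /= !rmorphXn /= rmorph1.
rewrite !rmorphM rmorphMn rmorphD /= !rmorphXn !H -/(e k) /=.
have -> : #|F|%:~R = x by [].
move: (#|@odd_Omega_involutions n F k|) => I IE.
have qp m : qpoch p m != 0.
  rewrite gt_eqF // -[p]expr1; apply: qpoch_gt0 (sqrV_exp_gt0 x_ge3 1) (sqrV_exp_le x_ge3 0) m.
exact: (involution_term x0 qp kn IE).
Qed.
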